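(* For every $2<p\le4$ there is a metric space $M$ that admits a bi-Lipschitz embedding into $\ell_1$ and into $\ell_r$ for every $r\ge p$, yet $M$ admits no bi-Lipschitz embedding into $L_q$ for any $1<q<p$. More generally, $M$ admits no bi-Lipschitz embedding into any Banach space whose modulus of uniform convexity has power type $q$ for some $2\le q<p$.
   Context: A map $\phi\colon (M,d_M)\to X$ is a bi-Lipschitz embedding if there are $0<a\le b<\infty$ with $a\,d_M(u,v)\le\|\phi(u)-\phi(v)\|\le b\,d_M(u,v)$ for all $u,v$. A Banach space $(X,\|\cdot\|)$ has modulus of uniform convexity of power type $q$ if there is $C>0$ such that $\|x+y\|\le2-C\|x-y\|^q$ for all unit vectors $x,y\in X$. *)

(* Defs.v *)
From HB Require Import structures.
From mathcomp Require Import all_boot all_order all_algebra.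
From mathcomp Require Import all_classical all_reals all_analysis.
Set Implicit Arguments. Unset Strict Implicit. Unset Printing Implicit Defensive.
Import Order.TTheory GRing.Theory Num.Theory.
Import numFieldNormedType.Exports.
Local Open Scope classical_set_scope.
Local Open Scope ring_scope.

Definition is_metric (R : realType) (M : Type) (d : M -> M -> R) : Prop :=
  (forall x y, 0 <= d x y) /\
  (forall x y, d x y = 0 <-> x = y) /\
  (forall x y, d x y = d y x) /\
  (forall x y z, d x z <= d x y + d y z).

Definition bi_lipschitz (R : realType) (M Y : Type)
  (dM : M -> M -> R) (dY : Y -> Y -> R) (f : M -> Y) : Prop :=
  exists a b : R, 0 < a /\ a <= b /\
    forall u v, a * dM u v <= dY (f u) (f v) /\ dY (f u) (f v) <= b * dM u v.

Definition in_ell (R : realType) (r : R) (x : nat -> R) : Prop :=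
  (\sum_(n <oo) ((`|x n| `^ r)%:E) < +oo)%E.

Definition ell_dist (R : realType) (r : R) (x y : nat -> R) : R :=
  (fine (\sum_(n <oo) ((`|x n - y n| `^ r)%:E))) `^ r^-1.

Definition bilip_embeds_ell (R : realType) (M : Type) (d : M -> M -> R) (r : R) : Prop :=
  exists f : M -> (nat -> R), (forall u, in_ell r (f u)) /\
    bi_lipschitz d (@ell_dist R r) f.

(* L_q = L_q[0,1] w.r.t. Lebesgue measure (functions up to a.e. equality,
   represented by measurable representatives; the distance is a pseudometric) *)
Definition in_Lq (R : realType) (q : R) (g : R -> R) : Prop :=
  measurable_fun (`[0%R, 1%R] : set R) g /\
  (\int[@lebesgue_measure R]_(x in (`[0%R, 1%R] : set R)) ((`|g x| `^ q)%:E) < +oo)%E.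

Definition Lq_dist (R : realType) (q : R) (g h : R -> R) : R :=
  (fine (\int[@lebesgue_measure R]_(x in (`[0%R, 1%R] : set R)) ((`|g x - h x| `^ q)%:E))) `^ q^-1.

Definition bilip_embeds_Lq (R : realType) (M : Type) (d : M -> M -> R) (q : R) : Prop :=
  exists f : M -> (R -> R), (forall u, in_Lq q (f u)) /\
    bi_lipschitz d (@Lq_dist R q) f.

Definition bilip_embeds_normed (R : realType) (M : Type) (d : M -> M -> R)
  (X : normedModType R) : Prop :=
  exists f : M -> X, bi_lipschitz d (fun x y : X => `|x - y|) f.

Definition unif_convex_power_type (R : realType) (X : normedModType R) (q : R) : Prop :=
  exists C : R, 0 < C /\
    forall x y : X, `|x| = 1 -> `|y| = 1 -> `|x + y| <= 2 - C * (`|x - y| `^ q).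

(* Main.v *)
(* Let [thin k = (k + 1) ^ (-1/p)].  The space is a wedge over [k] of copies M_k
   of a [k]-level Laakso graph (each edge is replaced by four edges in a row, the
   two in the middle being doubled), with metric |n - m| + thin k * (Laakso metric).
   A point is a pair of an integer [n], its position along the graph, and of one
   sign per level; [tent i n] measures how far the two branches of level [i] are
   apart at position [n].

   M_k is in L_1 because the Laakso graph is.  If the signs of two points differ
   exactly on the levels in T, their Laakso distance is comparable to
   |n - m| + sum_(i in T) tent i n, and since tents of different levels occur at
   well separated scales this sum is comparable to its largest term; so the
   coordinates n, thin k * (+-) tent i n embed M_k into l_r for all r >= p
   at once, because k * thin k ^ r <= 1.

   Conversely, uniform convexity of power type s forces the doubled middle of a
   stretched edge to lose a factor 1 - C * (thin k) ^ s, so that one of its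
   sub-edges is stretched more by the inverse factor.  Descending through the [k]
   levels, the stretch becomes at least 1 + C * k * (thin k) ^ s, which is
   unbounded in [k] when s < p. *)
Require Import Defs.
From HB Require Import structures.
From mathcomp Require Import all_boot all_order all_algebra.
From mathcomp Require Import all_classical all_reals all_analysis.
From mathcomp Require Import measurable_realfun.
From mathcomp Require Import zify ring lra.
Import Order.TTheory GRing.Theory Num.Theory.
Import numFieldNormedType.Exports.
Local Open Scope ring_scope.

Set Implicit Arguments.
Unset Strict Implicit.
Unset Printing Implicit Defensive.

(** * Laakso graphs *)

Section LaaksoGraph.
Local Open Scope nat_scope.

(** A hat function: each level interpolates the previous one linearly after scaling both axes by 4.
    Level [i] has period 4^(i+1), peak 4^i at 2 * 4^i, and vanishes outside the middle half of each
    period. *)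
Fixpoint tent (i n : nat) : nat :=
  if i is j.+1 then
    (n %% 4) * tent j (n %/ 4).+1 + (4 - n %% 4) * tent j (n %/ 4)
  else (n %% 4 == 2).

Definition swap12 (b : bool) (e : nat) : nat :=
  if b then (if e == 1 then 2 else if e == 2 then 1 else e) else e.

(* The set [[0, n)] after exchanging the base 4 digits 1 and 2 of its elements
   at the levels selected by [eps], the lowest digit coming first.  These sets
   represent the vertices of the Laakso graph in L_1. *)
Fixpoint laakso_cut (n : nat) (eps : seq bool) (x : nat) : bool :=
  if eps is b :: eps' then
    laakso_cut (n %/ 4 + (swap12 b (x %% 4) < n %% 4)) eps' (x %/ 4)
  else x < n.

(* Independent of [B] as soon as [n] and [m] are at most [4 ^ size eps * B]. *)
Definition cut_dist (B n : nat) (eps : seq bool) (m : nat) (del : seq bool) : nat :=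
  \sum_(x < 4 ^ size eps * B) (laakso_cut n eps x (+) laakso_cut m del x).

Definition tent_sum (eps del : seq bool) (n : nat) : nat :=
  \sum_(i < size eps | nth false eps i != nth false del i) tent i n.

(** * Tents: Lipschitz bounds, self-similarity, separation of scales *)

Lemma tent_lip i n : tent i n.+1 <= (tent i n).+1 /\ tent i n <= (tent i n.+1).+1.
Proof.
elim: i n => [|i IH] n /=; first by lia.
have := IH (n %/ 4).
have [E|E] : n.+1 %/ 4 = n %/ 4 /\ n.+1 %% 4 = (n %% 4).+1 \/
   n.+1 %/ 4 = (n %/ 4).+1 /\ n.+1 %% 4 = 0 /\ n %% 4 = 3 by lia.
  case: E => -> ->.
  have : n %% 4 < 4 by rewrite ltn_mod.
  by case: (n %% 4) => [|[|[|[|c]]]] //=; lia.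
by case: E => -> [-> ->]; lia.
Qed.

Lemma tent_dist i n m :
  tent i n <= tent i m + (n - m) + (m - n).
Proof.
have [nm|mn] := leqP n m.
- rewrite -(subnKC nm); elim: (m - n) => [|k IH]; first by rewrite addn0; lia.
  by rewrite addnS; have := tent_lip i (n + k); lia.
- rewrite -(subnKC (ltnW mn)); elim: (n - m) => [|k IH]; first by rewrite addn0; lia.
  by rewrite addnS; have := tent_lip i (m + k); lia.
Qed.

Lemma tent0 i : tent i 0 = 0.
Proof. by elim: i => //= i; rewrite div0n mod0n => ->. Qed.

Lemma tent_le i n : tent i n <= n.
Proof. by have := tent_dist i n 0; rewrite tent0; lia. Qed.

Lemma tent_le_exp i n : tent i n <= 4 ^ i.
Proof.
elim: i n => [|i IH] n /=; first by lia.
have := IH (n %/ 4); have := IH (n %/ 4).+1.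
have : n %% 4 < 4 by rewrite ltn_mod.
by rewrite expnS; case: (n %% 4) => [|[|[|[|c]]]] //=; lia.
Qed.

Lemma tent_mul4 i n : tent i.+1 (4 * n) = 4 * tent i n.
Proof. by rewrite /= modnMr mulKn. Qed.

Lemma tent_pow i j n : tent (j + i) (4 ^ j * n) = 4 ^ j * tent i n.
Proof.
elim: j => [|j IH]; first by rewrite !mul1n.
by rewrite addSn expnS -mulnA tent_mul4 IH mulnA.
Qed.

(** The support of [tent j] lies in the middle halves of the blocks of length 4^(j+1). On such a
    block [tent i] is affine, being either zero or of slope 1 or -1, and the distance to both ends
    of the block is at least 4^j. Treating [n] and [n.+1] together makes the induction pass through
    the interpolation. *)
Lemma tent_sep_pair j i n : j < i ->
  0 < maxn (tent j n) (tent j n.+1) -> 0 < maxn (tent i n) (tent i n.+1) ->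
  4 ^ j <= minn (tent i n) (tent i n.+1).
Proof.
elim: j i n => [|j IH] [|i] n //.
  move=> _ /=.
  have [E|[E|E]] : n %% 4 = 1 \/ n %% 4 = 2 \/ (n %% 4 = 0 \/ n %% 4 = 3) by lia.
  - have [-> ->] : n.+1 %/ 4 = n %/ 4 /\ n.+1 %% 4 = 2 by lia.
    by rewrite E; lia.
  - have [-> ->] : n.+1 %/ 4 = n %/ 4 /\ n.+1 %% 4 = 3 by lia.
    by rewrite E; lia.
  - by lia.
rewrite ltnS => ji.
have [E|E] : n.+1 %/ 4 = n %/ 4 /\ n.+1 %% 4 = (n %% 4).+1 \/
   n.+1 %/ 4 = (n %/ 4).+1 /\ n.+1 %% 4 = 0 /\ n %% 4 = 3 by lia.
  have := IH i (n %/ 4) ji; rewrite /= expnS.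
  case: E => -> ->.
  have : n %% 4 < 4 by rewrite ltn_mod.
  move: (tent _ _) (tent _ _) (tent _ _) (tent _ _) => a b c d.
  move: (4 ^ j) => q.
  by case: (n %% 4) => [|[|[|[|z]]]] //=; lia.
have := IH i (n %/ 4) ji; rewrite /= expnS.
case: E => -> [-> ->].
move: (tent _ _) (tent _ _) => a b.
move: (4 ^ j) => q. lia.
Qed.

Lemma tent_sep j i n : j < i -> 0 < tent j n -> 0 < tent i n -> 4 ^ j <= tent i n.
Proof. by move=> /tent_sep_pair -/(_ n); lia. Qed.

Lemma sum_ord_recr_cond (T : pred nat) (f : nat -> nat) k :
  \sum_(j < k.+1 | T j) f j = \sum_(j < k | T j) f j + (if T k then f k else 0).
Proof. by rewrite big_mkcond big_ord_recr [X in _ = X + _]big_mkcond. Qed.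

Lemma sum_exp4 k H : 3 * \sum_(j < k | 4 ^ j <= H) 4 ^ j <= 4 * H.
Proof.
elim: k => [|k IH]; first by rewrite big_ord0.
rewrite (sum_ord_recr_cond (fun j => 4 ^ j <= H) (expn 4)).
case: ifP => [kH|_]; last by rewrite addn0.
have lek : 3 * \sum_(j < k) 4 ^ j <= 4 ^ k.
  elim: (k) => [|l IHl]; first by rewrite big_ord0.
  by rewrite big_ord_recr /= expnS mulnDr [4 * _]mulSn leq_add2r.
rewrite mulnDr; apply: (@leq_trans (4 ^ k + 3 * 4 ^ k)).
  rewrite leq_add2r; apply: leq_trans lek.
  by rewrite leq_mul2l /= big_mkcond leq_sum // => i _; case: ifP.
by rewrite -mulSn leq_mul2l kH.
Qed.

(* The largest level [i] of [T] with a nonzero tent dominates: every lower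
   nonzero tent at level [j] has [tent j n <= 4 ^ j <= tent i n]. *)
Lemma tent_sum_max k (T : pred nat) n :
  0 < \sum_(j < k | T j) tent j n ->
  exists2 i, (i < k) && T i & \sum_(j < k | T j) tent j n <= 3 * tent i n.
Proof.
elim: k => [|k IH]; first by rewrite big_ord0.
rewrite (sum_ord_recr_cond T (tent^~ n)).
have IH' : 0 < \sum_(i < k | T i) tent i n ->
  exists2 i, (i < k.+1) && T i & \sum_(j < k | T j) tent j n <= 3 * tent i n.
  by move=> /IH[i /andP[ik Ti] le]; exists i => //; rewrite Ti ltnW.
case: ifP => Tk; last by rewrite addn0.
have [->|tk] := posnP (tent k n); first by rewrite addn0.
move=> _; exists k; first by rewrite ltnS leqnn.
suff : 3 * \sum_(i < k | T i) tent i n <= 4 * tent k n by lia.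
apply: leq_trans (sum_exp4 k (tent k n)).
rewrite leq_mul2l /= big_mkcond [X in _ <= X]big_mkcond leq_sum //= => i _.
case: ifP => // _; have [->|ti] := posnP (tent i n); first by [].
by rewrite (tent_sep (ltn_ord i) ti tk) tent_le_exp.
Qed.

(** * The cut distance, compared with tent sums *)

Lemma sum_ord_mul4 (f : nat -> nat) Q :
  \sum_(x < 4 * Q) f x = \sum_(e < 4) \sum_(x < Q) f (4 * x + e).
Proof.
rewrite exchange_big; elim: Q => [|Q IH]; first by rewrite muln0 !big_ord0.
rewrite [in RHS]big_ord_recr /= -IH mulnS addnC !addnS addn0.
do 4 rewrite big_ord_recr /=.
by do 4 rewrite big_ord_recr /=; rewrite big_ord0 addn0 add0n !addnS addn0 !addnA.
Qed.

Lemma digit4 x e : e < 4 -> (4 * x + e) %/ 4 = x /\ (4 * x + e) %% 4 = e.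
Proof. by lia. Qed.

(** Sorting [x] by its lowest base 4 digit [e] leaves four cut distances one scale up; all later
    estimates are inductions along this identity. *)
Lemma cut_dist_cons B n b eps m c del :
  cut_dist B n (b :: eps) m (c :: del) =
  \sum_(e < 4) cut_dist B (n %/ 4 + (swap12 b e < n %% 4)) eps
                          (m %/ 4 + (swap12 c e < m %% 4)) del.
Proof.
rewrite /cut_dist expnS -mulnA.
rewrite (sum_ord_mul4 (fun x => laakso_cut n (b :: eps) x (+) laakso_cut m (c :: del) x)).
apply: eq_bigr => e _; apply: eq_bigr => x _ /=.
by have [-> ->] := digit4 x (ltn_ord e).
Qed.

(** Exchanging digits permutes [0, 4^size eps * B), so the cut has as many elements as [0, n). *)
Lemma cut_mass B n eps : n <= 4 ^ size eps * B ->
  \sum_(x < 4 ^ size eps * B) laakso_cut n eps x = n.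
Proof.
elim: eps n => [|b eps IH] n /=; rewrite ?expnS -?mulnA.
  rewrite mul1n => nB; rewrite (eq_bigr (fun x : 'I_B => if x < n then 1 else 0)); last first.
    by move=> x _; case: ifP.
  by rewrite -big_mkcond -(big_ord_widen _ (fun=> 1) nB) sum_nat_const card_ord muln1.
move=> nB; rewrite (sum_ord_mul4 (fun x => laakso_cut n (b :: eps) x)).
have E (e : 'I_4) : \sum_(x < 4 ^ size eps * B) laakso_cut n (b :: eps) (4 * x + e) =
    n %/ 4 + (swap12 b e < n %% 4).
  rewrite -[RHS]IH; last by move: (swap12 b e) => z; lia.
  by apply: eq_bigr => x _ /=; have [-> ->] := digit4 x (ltn_ord e).
rewrite (eq_bigr _ (fun e _ => E e)) 4!big_ord_recr big_ord0 /= add0n.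
by case: b {E} => /=; lia.
Qed.

Lemma cut_out B n eps x : n <= 4 ^ size eps * B -> 4 ^ size eps * B <= x ->
  laakso_cut n eps x = false.
Proof.
elim: eps n x => [|b eps IH] n x /=; first by lia.
rewrite expnS -mulnA; move: (4 ^ _ * B) IH => Q IH nQ Qx.
by apply: IH; [move: (swap12 b (x %% 4)) => z|]; lia.
Qed.

Lemma cut_dist_sym B n eps m del : size eps = size del ->
  cut_dist B n eps m del = cut_dist B m del n eps.
Proof. by rewrite /cut_dist => ->; apply: eq_bigr => x _; rewrite addbC. Qed.

Lemma cut_dist_triangle B n eps m del l gam :
  size eps = size del ->
  cut_dist B n eps l gam <= cut_dist B n eps m del + cut_dist B m del l gam.
Proof.
rewrite /cut_dist => <-; rewrite -big_split; apply: leq_sum => x _ /=.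
by case: (laakso_cut _ _ _); case: (laakso_cut _ _ _); case: (laakso_cut _ _ _).
Qed.

(** A symmetric difference is at least as large as the difference of the cardinalities, which are
    [n] and [m] by [cut_mass]. *)
Lemma cut_dist_ge B n eps m del : size eps = size del ->
  n <= 4 ^ size eps * B -> m <= 4 ^ size eps * B ->
  (n - m) + (m - n) <= cut_dist B n eps m del.
Proof.
move=> sz nB mB.
have le n' m' eps' del' : size eps' = size del' -> n' <= 4 ^ size eps' * B ->
    m' <= 4 ^ size eps' * B -> n' <= m' + cut_dist B n' eps' m' del'.
  move=> sz' nB' mB'; rewrite -{1}(cut_mass nB').
  have mB2 : m' <= 4 ^ size del' * B by rewrite -sz'.
  rewrite -{1}(cut_mass mB2) -sz' /cut_dist -big_split.
  by apply: leq_sum => x _ /=; case: (laakso_cut _ _ _); case: (laakso_cut _ _ _).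
have := le _ _ _ _ sz nB mB.
have := le m n del eps (esym sz); rewrite -sz => /(_ mB nB).
by rewrite cut_dist_sym //; lia.
Qed.

Lemma cut_dist_nil B n m : n <= B -> m <= B ->
  cut_dist B n [::] m [::] = (n - m) + (m - n).
Proof.
have le n' m' : n' <= m' -> m' <= B -> cut_dist B n' [::] m' [::] = m' - n'.
  move=> nm mB; have nB := leq_trans nm mB.
  suff : n' + cut_dist B n' [::] m' [::] = m' by lia.
  have nB1 : n' <= 4 ^ size ([::] : seq bool) * B by rewrite mul1n.
  have mB1 : m' <= 4 ^ size ([::] : seq bool) * B by rewrite mul1n.
  rewrite -{1}(cut_mass nB1) -[RHS](cut_mass mB1) /cut_dist -big_split.
  by apply: eq_bigr => x _ /=; lia.
have [nm|mn] := leqP n m => nB mB; first by rewrite le //; lia.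
by rewrite cut_dist_sym // le; lia.
Qed.

Lemma tent_sum_cons b eps c del n :
  tent_sum (b :: eps) (c :: del) n = (b != c) * tent 0 n +
    (n %% 4 * tent_sum eps del (n %/ 4).+1 + (4 - n %% 4) * tent_sum eps del (n %/ 4)).
Proof.
rewrite /tent_sum big_mkcond big_ord_recl; congr (_ + _).
  by rewrite /=; case: (b != c); rewrite ?mul1n ?mul0n.
rewrite !big_distrr -big_split /= [RHS]big_mkcond /=.
by apply: eq_bigr => i _.
Qed.

Lemma tent_sum_refl eps n : tent_sum eps eps n = 0.
Proof. by rewrite /tent_sum big_pred0 // => i; rewrite eqxx. Qed.

(** Among the four coarse copies of [n], exactly [n %% 4] sit at [n %/ 4 + 1], so their tent sums
    recombine by [tent_sum_cons]. The coarse position gaps add up to |n - m|, except for an excess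
    of 2 when the lowest signs differ and n = m is 2 modulo 4; this is the term [tent 0 n]. *)
Lemma cut_dist_le B n eps m del : size eps = size del ->
  n <= 4 ^ size eps * B -> m <= 4 ^ size eps * B ->
  cut_dist B n eps m del <= (n - m) + (m - n) + 2 * tent_sum eps del n.
Proof.
elim: eps del n m => [|b eps IH] [|c del] // n m.
  by rewrite !mul1n /tent_sum big_ord0 => _ nB mB; rewrite cut_dist_nil // muln0 addn0.
move=> [sz]; rewrite /= expnS -mulnA => nB mB.
rewrite cut_dist_cons tent_sum_cons.
have IHe x y := IH del (n %/ 4 + x) (m %/ 4 + y) sz.
move: (4 ^ size eps * B) IHe nB mB => Q IHe nQ mQ.
pose f (e : 'I_4) := n %/ 4 + (swap12 b e < n %% 4) - (m %/ 4 + (swap12 c e < m %% 4)) +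
   (m %/ 4 + (swap12 c e < m %% 4) - (n %/ 4 + (swap12 b e < n %% 4))) +
   2 * tent_sum eps del (n %/ 4 + (swap12 b e < n %% 4)).
apply: (@leq_trans (\sum_e f e)).
  apply: leq_sum => e _; apply: IHe; move: (swap12 _ _) => z; lia.
rewrite 4!big_ord_recr big_ord0 /= add0n /f /= {f IHe IH}.
move: (tent_sum eps del) => S.
have [n' [d [En [Ed [d4 D]]]]] : exists n' d, n %/ 4 = n' /\ n %% 4 = d /\ d < 4 /\ n = 4 * n' + d.
  by exists (n %/ 4), (n %% 4); lia.
have [m' [d' [Em [Ed' [d4' D']]]]] : exists n' d, m %/ 4 = n' /\ m %% 4 = d /\ d < 4 /\ m = 4 * n' + d.
  by exists (m %/ 4), (m %% 4); lia.
rewrite En Ed Em Ed' D D' {En Ed Em Ed' D D' nQ mQ}.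
(* All remainders and both lowest signs are enumerated; each case is linear in the two coarse
   positions and their tent sums. *)
case: d d4 => [|[|[|[|d]]]] // _; case: d' d4' => [|[|[|[|d']]]] // _;
case: b; case: c; rewrite /swap12 /= ?addn0 ?addn1;
move: (S n') (S n'.+1) => s s'; lia.
Qed.

(* The bound at unequal nearby positions is what makes the induction go through:
   the four terms of [cut_dist_cons] compare positions differing by at most one. *)
Lemma cut_dist_tent_near B i n eps m del : size eps = size del ->
  n <= 4 ^ size eps * B -> m <= 4 ^ size eps * B -> n <= m.+1 -> m <= n.+1 ->
  i < size eps -> nth false eps i != nth false del i ->
  tent i n + tent i m <= cut_dist B n eps m del.
Proof.
elim: eps del i n m => [|b eps IH] [|c del] // i n m [sz].
rewrite /= expnS -mulnA => nB mB nm mn.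
rewrite cut_dist_cons.
have IHe j x y := IH del j (n %/ 4 + x) (m %/ 4 + y) sz.
have ge x y := @cut_dist_ge B (n %/ 4 + x) eps (m %/ 4 + y) del sz.
move: (4 ^ size eps * B) IHe ge nB mB => Q IHe ge nQ mQ.
case: i => [|i] /=.
  move=> _ bc; pose f (e : 'I_4) :=
    n %/ 4 + (swap12 b e < n %% 4) - (m %/ 4 + (swap12 c e < m %% 4)) +
    (m %/ 4 + (swap12 c e < m %% 4) - (n %/ 4 + (swap12 b e < n %% 4))).
  apply: (@leq_trans (\sum_e f e)); last first.
    by apply: leq_sum => e _; apply: ge; move: (swap12 _ _) => z; lia.
  rewrite 4!big_ord_recr big_ord0 /= add0n /f /= {f IHe IH ge}.
  have [n' [d [En [Ed [d4 D]]]]] : exists n' d, n %/ 4 = n' /\ n %% 4 = d /\ d < 4 /\ n = 4 * n' + d.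
    by exists (n %/ 4), (n %% 4); lia.
  have [m' [d' [Em [Ed' [d4' D']]]]] : exists n' d, m %/ 4 = n' /\ m %% 4 = d /\ d < 4 /\ m = 4 * n' + d.
    by exists (m %/ 4), (m %% 4); lia.
  rewrite En Ed Em Ed'; rewrite D D' in nm mn; move: nm mn => {En Ed Em Ed' D D' nQ mQ}.
  by case: d d4 => [|[|[|[|d]]]] // _; case: d' d4' => [|[|[|[|d']]]] // _;
     case: b bc; case: c; rewrite /swap12 //= ?addn0 ?addn1; lia.
rewrite ltnS => ik bc.
pose f (e : 'I_4) := tent i (n %/ 4 + (swap12 b e < n %% 4)) +
                     tent i (m %/ 4 + (swap12 c e < m %% 4)).
apply: (@leq_trans (\sum_e f e)); last first.
  apply: leq_sum => e _; rewrite /f; move: (swap12 b e) (swap12 c e) => y z.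
  by apply: IHe => //; lia.
rewrite 4!big_ord_recr big_ord0 /= add0n /f /= {f IHe IH ge}.
have tE l a : tent i (l %/ 4 + (swap12 a 0 < l %% 4)) + tent i (l %/ 4 + (swap12 a 1 < l %% 4)) +
   tent i (l %/ 4 + (swap12 a 2 < l %% 4)) + tent i (l %/ 4 + (swap12 a 3 < l %% 4)) =
   l %% 4 * tent i (l %/ 4).+1 + (4 - l %% 4) * tent i (l %/ 4).
  have : l %% 4 < 4 by rewrite ltn_mod.
  by case: (l %% 4) => [|[|[|[|d]]]] // _; case: a; rewrite /swap12 //= ?addn0 ?addn1; lia.
have := tE n b; have := tE m c; lia.
Qed.

(** The bound at equal positions is transported from [(n, del)] to [(m, del)] by the triangle
    inequality; with equal signs these two points are only |n - m| apart. *)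
Lemma cut_dist_tent B i n eps m del : size eps = size del ->
  n <= 4 ^ size eps * B -> m <= 4 ^ size eps * B ->
  i < size eps -> nth false eps i != nth false del i ->
  2 * tent i n <= cut_dist B n eps m del + ((n - m) + (m - n)).
Proof.
move=> sz nB mB ie ned.
have := cut_dist_tent_near sz nB nB (leqnSn n) (leqnSn n) ie ned.
have := @cut_dist_triangle B n eps m del n del sz.
have := @cut_dist_le B m del n del erefl; rewrite tent_sum_refl -sz.
by move=> /(_ mB nB); lia.
Qed.

Lemma tent_sum_le_cut_dist B n eps m del : size eps = size del ->
  n <= 4 ^ size eps * B -> m <= 4 ^ size eps * B ->
  2 * tent_sum eps del n <= 3 * (cut_dist B n eps m del + ((n - m) + (m - n))).
Proof.
move=> sz nB mB; have [->//|] := posnP (tent_sum eps del n).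
move=> /(@tent_sum_max _ (fun j => nth false eps j != nth false del j)).
move=> [i /andP[ie ned] le]; have := cut_dist_tent sz nB mB ie ned.
by rewrite -/(tent_sum _ _ _) in le; lia.
Qed.

End LaaksoGraph.

(** * Embeddings into l_1 and l_r *)

(** Lists a countable family as a sequence. [pickle_inv] is defined only on genuine codes, so every
    index occurs exactly once and all other entries are 0. *)
Definition flatten_coords (R : realType) (I : countType) (g : I -> R) (N : nat) : R :=
  oapp g 0 (pickle_inv N).

Lemma nneseries_flatten (R : realType) (I : countType) (g : I -> R) (s : seq I) :
  uniq s -> (forall i, 0 <= g i) -> (forall i, i \notin s -> g i = 0) ->
  (\sum_(N <oo) ((flatten_coords g N)%:E) = (\sum_(i <- s) g i)%:E)%E.
Proof.
move=> us g0 gs; pose B := (\max_(i <- s) pickle i).+1.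
have f0 N : 0 <= flatten_coords g N.
  by rewrite /flatten_coords; case: pickle_inv => //=.
have out N : N \notin map pickle s -> flatten_coords g N = 0.
  rewrite /flatten_coords; have := @pickle_invK I N.
  case: pickle_inv => [i|] //= iN Ns; apply: gs; apply: contraNN Ns => is_.
  by rewrite -iN map_f.
rewrite (nneseries_split 0 B); last by move=> k _; rewrite lee_fin.
rewrite eseries0 ?adde0; last first.
  move=> N BN _; rewrite out //; apply/negP => /mapP[i is_ iN].
  move: BN; rewrite add0n /B iN ltnNge => /negP; apply.
  by rewrite (big_rem i) //= leq_maxl.
rewrite sumEFin add0n; congr (_%:E).
have -> : \sum_(i <- s) g i = \sum_(k <- map pickle s) flatten_coords g k.
  by rewrite big_map; apply: eq_bigr => i _; rewrite /flatten_coords pickleK_inv.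
rewrite -(big_rmcond_in (mem (map pickle s))) /=; last by move=> k _ /out.
rewrite -big_filter; apply: perm_big; apply: uniq_perm.
- by rewrite filter_uniq // iota_uniq.
- by rewrite map_inj_uniq //; exact: pcan_inj pickleK_inv.
move=> k; rewrite mem_filter mem_index_iota /=.
apply/andP/idP => [[]//|ks]; split=> //.
by case/mapP: ks => i is_ ->; rewrite ltnS (big_rem i) //= leq_maxl.
Qed.

(** * The wedge as a direct sum: one block of coordinates for each [k], glued at the zero
    sequence *)

Section Wedge.
Variables (R : realType) (T : countType).
Implicit Types (g h : T -> R) (s : seq T) (k l : nat).

Definition in_fibre k g (i : nat * T) : R := if i.1 == k then g i.2 else 0.

Definition fibre_seq k g : nat -> R := flatten_coords (in_fibre k g).

Let sum_fibre k g s : \sum_(i <- [seq (k, j) | j <- s]) in_fibre k g i = \sum_(j <- s) g j.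
Proof. by rewrite big_map; apply: eq_bigr => j _; rewrite /in_fibre eqxx. Qed.

Lemma ell_fibre (r : R) k g s : 0 < r -> uniq s -> (forall j, j \notin s -> g j = 0) ->
  (\sum_(N <oo) ((`|fibre_seq k g N| `^ r)%:E) = (\sum_(j <- s) `|g j| `^ r)%:E)%E.
Proof.
move=> r0 us gs.
rewrite -(sum_fibre k (fun j => `|g j| `^ r)) -nneseries_flatten.
- congr (limn _); apply/funext => n; apply: eq_bigr => N _; congr (_%:E).
  rewrite /fibre_seq /flatten_coords; case: pickle_inv => [[k' j]|] /=.
    by rewrite /in_fibre /=; case: ifP => // _; rewrite normr0 powR0 ?gt_eqF.
  by rewrite normr0 powR0 ?gt_eqF.
- by rewrite map_inj_uniq // => i j [].
- by move=> i; rewrite /in_fibre; case: ifP => // _; exact: powR_ge0.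
- move=> [k' j] /=; rewrite /in_fibre /=; case: eqP => // -> js.
  rewrite gs ?normr0 ?powR0 ?gt_eqF //; apply: contraNN js => js.
  by rewrite map_f.
Qed.

Lemma in_ell_fibre (r : R) k g s : 0 < r -> uniq s -> (forall j, j \notin s -> g j = 0) ->
  in_ell r (fibre_seq k g).
Proof. by move=> r0 us gs; rewrite /in_ell (ell_fibre k r0 us gs) ltry. Qed.

Lemma fibre_seqB k g h N : fibre_seq k g N - fibre_seq k h N = fibre_seq k (g \- h) N.
Proof.
rewrite /fibre_seq /flatten_coords; case: pickle_inv => [[k' j]|] /=; rewrite ?subr0 //.
by rewrite /in_fibre; case: ifP => //; rewrite subr0.
Qed.

Lemma ell_dist_fibre (r : R) k g h s : 0 < r -> uniq s ->
  (forall j, j \notin s -> g j = 0) -> (forall j, j \notin s -> h j = 0) ->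
  ell_dist r (fibre_seq k g) (fibre_seq k h) = (\sum_(j <- s) `|g j - h j| `^ r) `^ r^-1.
Proof.
move=> r0 us gs hs; rewrite /ell_dist; congr (_ `^ _).
rewrite -[RHS]/(fine (_%:E)) -(ell_fibre k (g := g \- h)) //; last first.
  by move=> j js /=; rewrite gs // hs // subrr.
congr (fine (limn _)); apply/funext => n; apply: eq_bigr => N _.
by rewrite fibre_seqB.
Qed.

(** Different blocks have disjoint supports, so the r-th powers simply add. *)
Lemma ell_dist_fibre_neq (r : R) k l g h s t : 0 < r -> k != l -> uniq s -> uniq t ->
  (forall j, j \notin s -> g j = 0) -> (forall j, j \notin t -> h j = 0) ->
  ell_dist r (fibre_seq k g) (fibre_seq l h) =
  (\sum_(j <- s) `|g j| `^ r + \sum_(j <- t) `|h j| `^ r) `^ r^-1.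
Proof.
move=> r0 kl us ut gs ht; rewrite /ell_dist; congr (_ `^ _).
rewrite -[RHS]/(fine (_%:E)) EFinD -(ell_fibre k (g := g)) // -(ell_fibre l (g := h)) //.
rewrite -nneseriesD; [|by move=> *; rewrite lee_fin powR_ge0..].
congr (fine (limn _)); apply/funext => n; apply: eq_bigr => N _.
rewrite -EFinD /fibre_seq /flatten_coords; congr (_%:E).
have z0 : `|0 : R| `^ r = 0 by rewrite normr0 powR0 ?gt_eqF.
case: pickle_inv => [[k' j]|] /=; last by rewrite subr0 z0 addr0.
rewrite /in_fibre /=; case: (k' =P k) => [->|_]; last by rewrite sub0r normrN z0 add0r.
by rewrite (negPf kl) subr0 z0 addr0.
Qed.

End Wedge.

(** * Elementary inequalities for real powers *)

Section PowerSums.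
Variable R : realType.
Implicit Types (x y r : R).

Lemma powRVK x r : 0 <= x -> r != 0 -> (x `^ r) `^ r^-1 = x.
Proof. by move=> x0 r0; rewrite -powRrM mulfV // powRr1. Qed.

Lemma powRVKr x r : 0 <= x -> r != 0 -> (x `^ r^-1) `^ r = x.
Proof. by move=> x0 r0; rewrite -powRrM mulVf // powRr1. Qed.

Lemma powR_le2 r x y : 0 <= r -> 0 <= x -> x <= y -> x `^ r <= y `^ r.
Proof. by move=> r0 x0 xy; apply: ge0_ler_powR => //; rewrite nnegrE // (le_trans x0). Qed.

(** Write x^r as x * x^(r-1) and enlarge the second factor to (x+y)^(r-1). *)
Lemma powR_superadd r x y : 1 <= r -> 0 <= x -> 0 <= y -> x `^ r + y `^ r <= (x + y) `^ r.
Proof.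
move=> r1 x0 y0; have r0 : 0 < r by rewrite (lt_le_trans _ r1).
have rr : 0 <= r - 1 by rewrite subr_ge0.
rewrite -(mulr_powRB1 x0 r0) -(mulr_powRB1 y0 r0) -(mulr_powRB1 (addr_ge0 x0 y0) r0) mulrDl lerD // ler_wpM2l // powR_le2 //.
  by rewrite lerDl.
by rewrite lerDr.
Qed.

Lemma powR_sum_le (I : Type) (s : seq I) (f : I -> R) r : 1 <= r -> (forall i, 0 <= f i) ->
  \sum_(i <- s) f i `^ r <= (\sum_(i <- s) f i) `^ r.
Proof.
move=> r1 f0; elim: s => [|i s IH].
  by rewrite !big_nil powR_ge0.
rewrite !big_cons; apply: le_trans (powR_superadd r1 (f0 i) _).
  by rewrite lerD2l.
by apply: sumr_ge0.
Qed.

Lemma powRD_le r x y : 0 <= r -> 0 <= x -> 0 <= y ->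
  (x + y) `^ r <= 2 `^ r * (x `^ r + y `^ r).
Proof.
move=> r0 x0 y0; wlog xy : x y x0 y0 / x <= y.
  move=> H; have [/H->//|/ltW/H] := leP x y.
  by rewrite addrC [x `^ r + _]addrC; apply.
apply: (@le_trans _ _ ((2 * y) `^ r)).
  by apply: powR_le2; rewrite ?addr_ge0 //; lra.
by rewrite powRM // ler_wpM2l ?powR_ge0 // lerDr powR_ge0.
Qed.

End PowerSums.

(** * The points of the wedge and their coordinates in l_1 and l_r *)

Section Points.
Variables (R : realType) (p : R).
Hypothesis p2 : 2 < p.
Implicit Types (n m k : nat) (eps del : seq bool).

Definition thin k : R := k.+1%:R `^ (- p^-1).

(** The [false] coordinates carry the interval [0, n) and produce |n - m|; the [true] ones carry the
    Laakso cut. The length of [eps] is the number of levels and hence also selects the block. *)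
Definition ell1_coord n eps (j : bool * nat) : R :=
  if j.1 then thin (size eps) * (laakso_cut n eps j.2)%:R else (j.2 < n)%N%:R.

Definition ell1_pt n eps : nat -> R := fibre_seq (size eps) (ell1_coord n eps).

Definition ellr_coord n eps j : R :=
  if j is i.+1 then
    if (i < size eps)%N then thin (size eps) * ((-1) ^+ nth false eps i * (tent i n)%:R)
    else 0
  else n%:R.

Definition ellr_pt n eps : nat -> R := fibre_seq (size eps) (ellr_coord n eps).

Let p0 : 0 < p. Proof. by rewrite (lt_trans _ p2). Qed.

Lemma thin_gt0 k : 0 < thin k.
Proof. by rewrite powR_gt0 // ltr0n. Qed.

Lemma thin_le1 k : thin k <= 1.
Proof.
rewrite /thin -[leRHS](powRr0 k.+1%:R) ler_powR //; first by rewrite ler1n.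
by rewrite oppr_le0 invr_ge0 ltW.
Qed.

Lemma thin_powR k : thin k `^ p = k.+1%:R^-1.
Proof. by rewrite /thin -powRrM mulNr mulVf ?gt_eqF // powR_inv1. Qed.

Lemma sum_thin_le1 k r : p <= r -> k%:R * thin k `^ r <= 1.
Proof.
move=> pr; apply: (@le_trans _ _ (k%:R * thin k `^ p)).
  by rewrite ler_wpM2l // ger_powR // thin_gt0 thin_le1.
by rewrite thin_powR ler_pdivrMr ?ltr0n // mul1r ler_nat.
Qed.

Definition ell1_supp N : seq (bool * nat) :=
  [seq (b, x) | b <- [:: false; true], x <- index_iota 0 N].

Let ell1_supp_uniq N : uniq (ell1_supp N).
Proof. by apply: allpairs_uniq => //; [exact: iota_uniq | case=> ? ? [? ?] _ _]. Qed.

Let ell1_suppP B n eps : (n <= 4 ^ size eps * B)%N ->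
  forall j, j \notin ell1_supp (4 ^ size eps * B) -> ell1_coord n eps j = 0.
Proof.
move=> nB [b x]; rewrite /ell1_coord /= => bx.
have xN : (4 ^ size eps * B <= x)%N.
  rewrite leqNgt; apply: contraNN bx => xN.
  by apply: allpairs_f; [case: b | rewrite mem_index_iota].
case: b bx => _; first by rewrite (cut_out nB xN) mulr0.
by rewrite ltnNge (leq_trans nB xN).
Qed.

Let sum_ell1_supp (f : bool * nat -> R) N :
  \sum_(j <- ell1_supp N) f j = \sum_(x < N) f (false, nat_of_ord x) + \sum_(x < N) f (true, nat_of_ord x).
Proof.
by rewrite /ell1_supp big_allpairs !big_cons big_nil /= !big_mkord addr0.
Qed.

Lemma in_ell1_pt n eps : in_ell 1 (ell1_pt n eps).
Proof.
have nB : (n <= 4 ^ size eps * n)%N by rewrite leq_pmull // expn_gt0.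
exact: in_ell_fibre (ell1_supp_uniq _) (ell1_suppP nB).
Qed.

Lemma ell1_dist_same B n eps m del : size eps = size del ->
  (n <= 4 ^ size eps * B)%N -> (m <= 4 ^ size eps * B)%N ->
  ell_dist 1 (ell1_pt n eps) (ell1_pt m del) =
  ((n - m) + (m - n))%N%:R + thin (size eps) * (cut_dist B n eps m del)%:R.
Proof.
move=> sz nB mB.
have mB' : (m <= 4 ^ size del * B)%N by rewrite -sz.
rewrite /ell1_pt -sz (ell_dist_fibre _ _ (ell1_supp_uniq (4 ^ size eps * B))) //; last 2 first.
- exact: ell1_suppP.
- by rewrite sz; exact: ell1_suppP.
rewrite invr1 powRr1; last by apply: sumr_ge0 => *; exact: powR_ge0.
rewrite sum_ell1_supp; congr (_ + _).
  rewrite -(@cut_dist_nil (4 ^ size eps * B)) // /cut_dist mul1n natr_sum.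
  apply: eq_bigr => x _; rewrite powRr1 // /ell1_coord /=.
  by case: (x < n)%N; case: (x < m)%N; rewrite /= ?subrr ?subr0 ?sub0r ?normrN ?normr1 ?normr0.
rewrite /cut_dist natr_sum mulr_sumr; apply: eq_bigr => x _.
rewrite powRr1 // /ell1_coord /= -sz -mulrBr normrM gtr0_norm ?thin_gt0 //; congr (_ * _).
by case: (laakso_cut _ _ _); case: (laakso_cut _ _ _); rewrite /= ?subrr ?subr0 ?sub0r ?normrN ?normr1 ?normr0.
Qed.

(** Points of different blocks are joined through the wedge point, so their distances to it add. *)
Lemma ell1_dist_diff n eps m del : size eps != size del ->
  ell_dist 1 (ell1_pt n eps) (ell1_pt m del) =
  (1 + thin (size eps)) * n%:R + (1 + thin (size del)) * m%:R.
Proof.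
move=> sz.
have le l (gam : seq bool) : (l <= 4 ^ size gam * l)%N by rewrite leq_pmull // expn_gt0.
rewrite /ell1_pt (ell_dist_fibre_neq _ sz (ell1_supp_uniq (4 ^ size eps * n)) (ell1_supp_uniq (4 ^ size del * m))) //; last 2 first.
- exact: ell1_suppP.
- exact: ell1_suppP.
rewrite invr1 powRr1; last first.
  by apply: addr_ge0; apply: sumr_ge0 => *; exact: powR_ge0.
have sumE l gam : \sum_(j <- ell1_supp (4 ^ size gam * l)) `|ell1_coord l gam j| `^ 1 =
   (1 + thin (size gam)) * l%:R.
  rewrite sum_ell1_supp mulrDl mul1r; congr (_ + _).
    have lB : (l <= 4 ^ size ([::] : seq bool) * (4 ^ size gam * l))%N by rewrite mul1n.
    rewrite -[in RHS](cut_mass lB) mul1n natr_sum; apply: eq_bigr => x _.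
    by rewrite powRr1 // /ell1_coord /= ger0_norm.
  rewrite -[in RHS](cut_mass (le l gam)) natr_sum mulr_sumr; apply: eq_bigr => x _.
  by rewrite powRr1 // /ell1_coord /= ger0_norm // mulr_ge0 // ltW // thin_gt0.
by rewrite !sumE.
Qed.

Section FiniteExponent.
Variable r : R.
Hypothesis pr : p <= r.

Let r1 : 1 <= r. Proof. by have := p2; have := pr; lra. Qed.
Let r0 : 0 < r. Proof. by rewrite (lt_le_trans _ r1). Qed.
Let rn0 : r != 0. Proof. by rewrite gt_eqF. Qed.
Let rV0 : 0 <= r^-1. Proof. by rewrite invr_ge0 ltW. Qed.

Let ellr_suppP n eps j : j \notin iota 0 (size eps).+1 -> ellr_coord n eps j = 0.
Proof.
by rewrite mem_iota /= add0n ltnS -ltnNge; case: j => // j; rewrite ltnS leqNgt /=; case: ifP.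
Qed.

Let sum_iota (f : nat -> R) k : \sum_(j <- iota 0 k.+1) f j = f 0%N + \sum_(i < k) f i.+1.
Proof. by rewrite -[iota 0 k.+1]/(index_iota 0 k.+1) big_mkord big_ord_recl. Qed.

Lemma in_ellr_pt n eps : in_ell r (ellr_pt n eps).
Proof. exact: in_ell_fibre r0 (iota_uniq _ _) (@ellr_suppP n eps). Qed.

Let coord_le_sum (s : seq nat) (f : nat -> R) j : j \in s -> (forall i, 0 <= f i) ->
  f j <= (\sum_(i <- s) f i `^ r) `^ r^-1.
Proof.
move=> js f0; rewrite -[leLHS](powRVK _ rn0) //.
apply: powR_le2; rewrite ?powR_ge0 //.
by rewrite (big_rem j) //= lerDl sumr_ge0 // => *; exact: powR_ge0.
Qed.

Let ellr_norm n eps := (\sum_(j <- iota 0 (size eps).+1) `|ellr_coord n eps j| `^ r).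

Let ellr_norm_le n eps : ellr_norm n eps <= 2 * n%:R `^ r.
Proof.
rewrite /ellr_norm sum_iota /= normr_nat mulr2n mulrDl mul1r lerD2l.
apply: (@le_trans _ _ (\sum_(i < size eps) (thin (size eps) * n%:R) `^ r)).
  apply: ler_sum => i _; rewrite ltn_ord; apply: powR_le2; rewrite ?(ltW r0) //.
  rewrite !normrM normrX normrN1 expr1n mul1r gtr0_norm ?thin_gt0 //.
  by rewrite ler_wpM2l ?(ltW (thin_gt0 _)) // normr_nat ler_nat tent_le.
rewrite sumr_const card_ord -[leLHS]mulr_natl powRM ?(ltW (thin_gt0 _)) // mulrA.
by rewrite ler_piMl ?powR_ge0 // sum_thin_le1.
Qed.

Lemma ellr_dist_diff n eps m del : size eps != size del ->
  let d := ell_dist 1 (ell1_pt n eps) (ell1_pt m del) in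
  let e := ell_dist r (ellr_pt n eps) (ellr_pt m del) in
  8^-1 * d <= e /\ e <= 16 * d.
Proof.
move=> sz /=; rewrite ell1_dist_diff //.
rewrite /ellr_pt (ell_dist_fibre_neq r0 sz (iota_uniq _ _) (iota_uniq _ _)
  (@ellr_suppP n eps) (@ellr_suppP m del)) -!/(ellr_norm _ _).
set e := _ `^ r^-1.
have nn l gam : 0 <= ellr_norm l gam by apply: sumr_ge0 => *; exact: powR_ge0.
have [t0 t1] := (thin_gt0 (size eps), thin_le1 (size eps)).
have [t0' t1'] := (thin_gt0 (size del), thin_le1 (size del)).
have lee l gam : ellr_norm l gam <= ellr_norm n eps + ellr_norm m del -> l%:R <= e.
  move=> le; apply: (@le_trans _ _ (ellr_norm l gam `^ r^-1)).
    have := @coord_le_sum (iota 0 (size gam).+1) (fun j => `|ellr_coord l gam j|) 0%N.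
    by rewrite /= normr_nat; apply => //; rewrite mem_iota.
  exact: powR_le2.
have ne : n%:R <= e by apply: (lee n eps); rewrite lerDl.
have me : m%:R <= e by apply: (lee m del); rewrite lerDr.
have eu : e <= 2 * (n%:R + m%:R).
  rewrite /e -[leRHS](powRVK _ rn0) ?mulr_ge0 ?addr_ge0 //.
  apply: powR_le2; rewrite ?addr_ge0 //.
  apply: (le_trans (lerD (ellr_norm_le n eps) (ellr_norm_le m del))).
  rewrite -mulrDr powRM ?addr_ge0 //; apply: ler_pM; rewrite ?addr_ge0 ?powR_ge0 //.
    by rewrite le1r_powR // ler1n.
  exact: powR_superadd.
have n0 : 0 <= n%:R :> R by [].
have m0 : 0 <= m%:R :> R by [].
split; nra.
Qed.

(** Put c = |n - m|, t = [thin], N the cut distance and S the tent sum, so that d = c + t N. From c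
    <= e, t S <= 3 e and N <= c + 2 S follows d <= 8 e; from e <= 4 (c + 2 t S) and 2 S <= 3 (N + c)
    follows e <= 16 d. *)
Lemma ellr_dist_same n eps m del : size eps = size del ->
  let d := ell_dist 1 (ell1_pt n eps) (ell1_pt m del) in
  let e := ell_dist r (ellr_pt n eps) (ellr_pt m del) in
  8^-1 * d <= e /\ e <= 16 * d.
Proof.
move=> sz /=; pose B := (n + m)%N.
have nB : (n <= 4 ^ size eps * B)%N by rewrite (leq_trans (leq_addr m n)) // leq_pmull // expn_gt0.
have mB : (m <= 4 ^ size eps * B)%N by rewrite (leq_trans (leq_addl n m)) // leq_pmull // expn_gt0.
rewrite (ell1_dist_same sz nB mB).
rewrite /ellr_pt -sz (ell_dist_fibre _ r0 (iota_uniq 0 (size eps).+1)); last 2 first.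
- exact: ellr_suppP.
- by rewrite sz; exact: ellr_suppP.
set c := ((n - m) + (m - n))%N; set N := cut_dist _ _ _ _ _.
set e := _ `^ r^-1; set t := thin _.
have [t0 t1] : 0 < t /\ t <= 1 by split; [exact: thin_gt0 | exact: thin_le1].
pose f j := `|ellr_coord n eps j - ellr_coord m del j|.
have fe j : (j < (size eps).+1)%N -> f j <= e.
  by move=> js; apply: (@coord_le_sum (iota 0 (size eps).+1) f) => [|i]; [rewrite mem_iota | exact: normr_ge0].
have f0E : f 0%N = c%:R.
  rewrite /f /= /c; have [nm|/ltnW mn] := leqP n m.
    by rewrite (eqP nm) add0n distrC -natrB // normr_nat.
  by rewrite (eqP mn) addn0 -natrB // normr_nat.
have tabs i : `|(tent i n)%:R - (tent i m)%:R : R| <= c%:R.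
  have := tent_dist i n m; have := tent_dist i m n; rewrite -!addnA -/c [(m - n + _)%N]addnC -/c.
  by rewrite -!(ler_nat R) !natrD ler_norml; lra.
pose T i := nth false eps i != nth false del i.
have fT i : (i < size eps)%N -> T i -> f i.+1 = t * ((tent i n)%:R + (tent i m)%:R).
  move=> ie; rewrite /T /f /= ie -sz ie -/t -mulrBr normrM gtr0_norm //.
  case: (nth _ eps i); case: (nth _ del i) => //= _; congr (_ * _).
    by rewrite expr1 expr0 mul1r mulN1r -opprD normrN ger0_norm // addr_ge0.
  by rewrite expr1 expr0 mul1r mulN1r opprK ger0_norm // addr_ge0.
set S := tent_sum eps del n.
(* On the dominant level the signs are opposite, so this single coordinate already sees at least a
   third of t S. *)
have Se : t * S%:R <= 3 * e.
  have e0 : 0 <= e by exact: powR_ge0.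
  have [->|] := posnP S; first by rewrite mulr0 mulr_ge0.
  move=> /(@tent_sum_max _ T)[i /andP[ie Ti]]; rewrite -/S => le.
  have := fe i.+1 ie; rewrite fT // => fi.
  have le' : S%:R <= 3 * (tent i n)%:R :> R by rewrite -natrM ler_nat.
  have := mulr_ge0 (ltW t0) (ler0n R (tent i m)).
  by have := ler_wpM2l (ltW t0) le'; lra.
have NS : N%:R <= c%:R + 2 * S%:R :> R.
  by rewrite -natrM -natrD ler_nat; exact: cut_dist_le.
have SN : 2 * S%:R <= 3 * (N%:R + c%:R) :> R.
  by rewrite -natrD -!natrM ler_nat; exact: tent_sum_le_cut_dist.
have ce : c%:R <= e by rewrite -f0E; apply: fe.
have [c0 N0 S0] : [/\ 0 <= c%:R :> R, 0 <= N%:R :> R & 0 <= S%:R :> R] by [].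
have eu : e <= 4 * (c%:R + 2 * (t * S%:R)).
  have cS0 : 0 <= c%:R + 2 * (t * S%:R) by rewrite addr_ge0 // mulr_ge0 // mulr_ge0 // ltW.
  have r0' := ltW r0.
  rewrite /e -[leRHS](powRVK _ rn0) ?mulr_ge0 //; apply: powR_le2 => //.
    by apply: sumr_ge0 => *; exact: powR_ge0.
  rewrite (sum_iota (fun j => f j `^ r)) f0E.
  (* The difference in coordinate [i.+1] is at most t c + g i: with equal signs the tents differ by
     at most c, and with opposite signs [tent i m] is at most [tent i n] + c. *)
  pose g i : R := 2 * (t * (if T i then (tent i n)%:R else 0)).
  have g0 i : 0 <= g i.
    by rewrite /g; case: ifP => _; rewrite ?mulr0 // mulr_ge0 // mulr_ge0 // ltW.
  have fg (i : 'I_(size eps)) : f i.+1 `^ r <= 2 `^ r * ((t * c%:R) `^ r + g i `^ r).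
    apply: le_trans (powRD_le r0' _ (g0 i)); last by rewrite mulr_ge0 // ltW.
    apply: powR_le2 => //; first exact: normr_ge0.
    have := tabs i; rewrite /g; have [Ti|/negPf nTi] := boolP (T i).
      rewrite fT // ler_norml => /andP[le _].
      by move: (_%:R) (_%:R) c%:R le => x y z; nra.
    move=> le; rewrite !mulr0 addr0 /f /= ltn_ord -sz ltn_ord -/t -mulrBr.
    move: nTi; rewrite /T => /eqP ->.
    by rewrite -mulrBr !normrM normrX normrN1 expr1n mul1r gtr0_norm // ler_pM2l.
  (* The parts t c contribute at most c^r because k * t^r <= 1, and the parts g i at most the r-th
     power of their sum 2 t S. *)
  apply: (@le_trans _ _ (c%:R `^ r + 2 `^ r * (c%:R `^ r + (2 * (t * S%:R)) `^ r))).
    rewrite lerD2l; apply: le_trans (ler_sum _ (fun i _ => fg i)) _.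
    rewrite -mulr_sumr ler_wpM2l ?powR_ge0 // big_split /= lerD //.
      rewrite sumr_const card_ord -[leLHS]mulr_natl powRM ?(ltW t0) // mulrA.
      by rewrite ler_piMl ?powR_ge0 // sum_thin_le1.
    apply: (le_trans (powR_sum_le _ r1 _)) => //.
    apply: powR_le2 => //; first by apply: sumr_ge0.
    rewrite -!mulr_sumr /S /tent_sum natr_sum; do 2 rewrite ler_wpM2l ?(ltW t0) //.
    by rewrite [leRHS]big_mkcond.
  have c1 : c%:R `^ r <= (c%:R + 2 * (t * S%:R)) `^ r.
    by apply: powR_le2 => //; rewrite lerDl mulr_ge0 // mulr_ge0 // ltW.
  have c2 : c%:R `^ r + (2 * (t * S%:R)) `^ r <= (c%:R + 2 * (t * S%:R)) `^ r.
    by apply: powR_superadd => //; rewrite mulr_ge0 // mulr_ge0 // ltW.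
  (* With 2 <= 2^r the total factor 1 + 2^r is at most 4^r. *)
  have two : 2 <= 2 `^ r :> R by rewrite le1r_powR // ler1n.
  have -> : (4 * (c%:R + 2 * (t * S%:R))) `^ r = 2 `^ r * (2 `^ r * (c%:R + 2 * (t * S%:R)) `^ r).
    by rewrite -!powRM // ?mulr_ge0 //; congr (_ `^ _); ring.
  have M0 := powR_ge0 (c%:R + 2 * (t * S%:R)) r.
  have w0 : 0 <= 2 `^ r :> R by exact: powR_ge0.
  have h1 := ler_wpM2l w0 c2.
  have h2 := ler_wpM2r (mulr_ge0 w0 M0) two.
  have h3 := ler_wpM2r M0 two.
  by lra.
split; nra.
Qed.

Lemma ellr_dist_bounds n eps m del :
  let d := ell_dist 1 (ell1_pt n eps) (ell1_pt m del) in
  let e := ell_dist r (ellr_pt n eps) (ellr_pt m del) in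
  8^-1 * d <= e /\ e <= 16 * d.
Proof.
by have [sz|sz] := eqVneq (size eps) (size del);
  [exact: ellr_dist_same | exact: ellr_dist_diff].
Qed.

End FiniteExponent.
End Points.

(** * Non-embedding under uniform convexity *)

Section Ell1Metric.
Variable R : realType.
Implicit Types u v w : nat -> R.

Let ell1_sum u := (\sum_(n <oo) ((`|u n| `^ 1)%:E))%E.

Let ell1_sum_ge0 u : (0 <= ell1_sum u)%E.
Proof. by apply: nneseries_ge0 => n _ _; rewrite lee_fin powR_ge0. Qed.

Let ell1_sum_le u v w : (forall n, `|u n| <= `|v n| + `|w n|) ->
  (ell1_sum u <= ell1_sum v + ell1_sum w)%E.
Proof.
move=> le; rewrite /ell1_sum -nneseriesD; [|by move=> *; rewrite lee_fin powR_ge0..].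
apply: lee_nneseries => n *; first by rewrite lee_fin powR_ge0.
by rewrite lee_fin !powRr1.
Qed.

Let in_ell1_fin u : in_ell 1 u -> ell1_sum u \is a fin_num.
Proof. by move=> fu; rewrite ge0_fin_numE. Qed.

Lemma in_ell1B u v : in_ell 1 u -> in_ell 1 v -> in_ell 1 (fun n => u n - v n).
Proof.
move=> fu fv; apply: (@le_lt_trans _ _ (ell1_sum u + ell1_sum v)%E).
  by apply: ell1_sum_le => n; exact: ler_normB.
exact: lte_add_pinfty.
Qed.

Let ell1_distE u v : ell_dist 1 u v = fine (ell1_sum (fun n => u n - v n)).
Proof. by rewrite /ell_dist invr1 powRr1 //; apply: fine_ge0; exact: ell1_sum_ge0. Qed.

Lemma ell1_dist_refl u : ell_dist 1 u u = 0.
Proof.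
rewrite ell1_distE /ell1_sum eseries0 // => n _ _.
by rewrite subrr normr0 powR0 // oner_neq0.
Qed.

Lemma ell1_dist_eq0 u v : in_ell 1 u -> in_ell 1 v -> ell_dist 1 u v = 0 -> u = v.
Proof.
move=> fu fv; rewrite ell1_distE => d0; apply/funext => n.
have fin := in_ell1_fin (in_ell1B fu fv).
apply/eqP; rewrite -subr_eq0 -normr_le0 -[leLHS]powRr1 // -lee_fin.
rewrite -d0 fineK //; apply: le_trans (nneseries_lim_ge n.+1 _); last first.
  by move=> *; rewrite lee_fin powR_ge0.
by rewrite big_nat_recr //= leeDr // sume_ge0 // => *; rewrite lee_fin powR_ge0.
Qed.

Lemma ell1_dist_sym u v : ell_dist 1 u v = ell_dist 1 v u.
Proof.
rewrite !ell1_distE; congr (fine (limn _)); apply/funext => k.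
by apply: eq_bigr => n _; rewrite distrC.
Qed.

(** Membership in l_1 matters here: [fine] would send a divergent sum to 0. *)
Lemma ell1_dist_triangle u v w : in_ell 1 u -> in_ell 1 v -> in_ell 1 w ->
  ell_dist 1 u w <= ell_dist 1 u v + ell_dist 1 v w.
Proof.
move=> fu fv fw; have f1 := in_ell1_fin (in_ell1B fu fv).
have f2 := in_ell1_fin (in_ell1B fv fw); have f3 := in_ell1_fin (in_ell1B fu fw).
rewrite !ell1_distE -(fineD f1 f2); apply: fine_le => //; first by rewrite fin_numD f1.
apply: ell1_sum_le => n.
have -> : u n - w n = (u n - v n) + (v n - w n) by ring.
exact: ler_normD.
Qed.

End Ell1Metric.

(* [s] plays the part of the exponent of uniform convexity: a quadrilateral
   [a, m, b, m'] with nearly straight sides and a diagonal [m m'] of relative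
   length [delta] makes the path from [u] to [v] shorter than the sum of its edges. *)
Definition laakso_convex (R : realType) (Y : Type) (D : Y -> Prop) (rho : Y -> Y -> R) (s : R) :=
  exists2 C : R, 0 < C & forall u a m m' b v, D u -> D a -> D m -> D m' -> D b -> D v ->
    forall l delta, 0 < l -> 0 < delta -> delta <= 1 ->
    rho u a <= l -> rho a m <= l -> rho m b <= l -> rho a m' <= l -> rho m' b <= l ->
    rho b v <= l -> delta * l <= rho m m' ->
    rho u v <= 4 * l * (1 - C * delta `^ s).

Lemma bernoulli_le (R : realType) (x : R) k : 0 <= x -> 1 + k%:R * x <= (1 + x) ^+ k.
Proof.
move=> x0; elim: k => [|k IHk]; first by rewrite mul0r addr0 expr0.
rewrite exprS; apply: le_trans (ler_wpM2l _ IHk); last by lra.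
have : 0 <= k%:R * x * x by rewrite !mulr_ge0.
by rewrite -natr1; nra.
Qed.

(** * Descent through the levels of a Laakso graph *)

Section NonEmbedding.
Variables (R : realType) (p : R).
Hypothesis p2 : 2 < p.

Let dist n eps m del := ell_dist 1 (ell1_pt p n eps) (ell1_pt p m del).

Let p0 : 0 < p. Proof. by rewrite (lt_trans _ p2). Qed.

Let le4l k n m : (n <= 4 ^ k * (n + m))%N.
Proof. by rewrite (leq_trans (leq_addr m n)) // leq_pmull // expn_gt0. Qed.
Let le4r k n m : (m <= 4 ^ k * (n + m))%N.
Proof. by rewrite (leq_trans (leq_addl n m)) // leq_pmull // expn_gt0. Qed.

Lemma ell1_dist_line n m eps : (n <= m)%N ->
  dist n eps m eps = (1 + thin p (size eps)) * (m - n)%N%:R.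
Proof.
move=> nm; rewrite /dist (@ell1_dist_same _ _ (n + m)) //.
have E : ((n - m) + (m - n) = m - n)%N by lia.
rewrite E mulrDl mul1r; congr (_ + _ * _%:R); apply/eqP; rewrite eqn_leq.
have := cut_dist_ge (erefl (size eps)) (le4l (size eps) n m) (le4r (size eps) n m).
have := cut_dist_le (erefl (size eps)) (le4l (size eps) n m) (le4r (size eps) n m).
by rewrite tent_sum_refl E; lia.
Qed.

Let tent_odd1 n : tent 0 (4 * n + 1) = 0%N. Proof. by rewrite /=; lia. Qed.
Let tent_odd3 n : tent 0 (4 * n + 3) = 0%N. Proof. by rewrite /=; lia. Qed.
Let tent_mid n : tent 0 (4 * n + 2) = 1%N. Proof. by rewrite /=; lia. Qed.

Let flip j (eps : seq bool) := set_nth false eps j (~~ nth false eps j).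

Let size_flip j eps : (j < size eps)%N -> size (flip j eps) = size eps.
Proof. by move=> je; rewrite size_set_nth; apply/maxn_idPr. Qed.

(** Where the tent of level [j] vanishes the two branches of that level meet, so both sign choices
    name one point. *)
Let ell1_pt_flip j n eps : (j < size eps)%N -> tent j n = 0%N ->
  ell1_pt p n eps = ell1_pt p n (flip j eps).
Proof.
move=> je t0; apply: ell1_dist_eq0; [exact: in_ell1_pt..|].
have sz := esym (size_flip je).
rewrite (@ell1_dist_same _ _ (n + n)) //.
have := cut_dist_le sz (le4l (size eps) n n) (le4r (size eps) n n).
have -> : tent_sum eps (flip j eps) n = 0%N.
  rewrite /tent_sum big1 // => i; rewrite nth_set_nth /=.
  by have [->//|_] := eqVneq (i : nat) j; rewrite eqxx.
by rewrite subnn muln0 !addn0 leqn0 => /eqP ->; rewrite mulr0 addr0.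
Qed.

Let ell1_dist_flip j n eps : (j < size eps)%N ->
  thin p (size eps) * (2 * (tent j n)%:R) <= dist n eps n (flip j eps).
Proof.
move=> je; rewrite /dist (@ell1_dist_same _ _ (n + n)) //; last by rewrite size_flip.
rewrite subnn add0r ler_pM2l ?thin_gt0 // -natrM ler_nat.
have sz := esym (size_flip je).
have := cut_dist_tent sz (le4l (size eps) n n) (le4r (size eps) n n) je.
by rewrite subnn !addn0; apply; rewrite nth_set_nth /= eqxx; case: nth.
Qed.

Lemma laakso_convex_no_embedding (Y : Type) (D : Y -> Prop) (rho : Y -> Y -> R) (s : R)
    (f : nat -> seq bool -> Y) (a b : R) :
  0 <= s -> s < p -> laakso_convex D rho s -> (forall n eps, D (f n eps)) ->
  (forall n eps m del, ell1_pt p n eps = ell1_pt p m del -> f n eps = f m del) ->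
  0 < a -> a <= b ->
  ~ forall n eps m del, a * dist n eps m del <= rho (f n eps) (f m del) /\
                        rho (f n eps) (f m del) <= b * dist n eps m del.
Proof.
move=> s0 sp [C C0 conv] Df fext a0 ab bil.
have b0 : 0 < b by rewrite (lt_le_trans a0).
(* After [i] of the [k] descents some edge of scale 4^j, whose length is (1 + thin) 4^j, is still
   stretched by a factor a (1 + eta)^i. *)
have growth k : let eta := C * (thin p k * (a / b)) `^ s in
    forall i j, (i + j)%N = k -> exists n eps, size eps = k /\
      a * (1 + thin p k) * (4 ^ j)%:R * (1 + eta) ^+ i <=
      rho (f (n * 4 ^ j)%N eps) (f (n.+1 * 4 ^ j)%N eps).
  move=> eta; have [t0 t1] := (thin_gt0 p k, thin_le1 p2 k).
  have ab0 : 0 < a / b by rewrite divr_gt0.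
  have ab1 : a / b <= 1 by rewrite ler_pdivrMr // mul1r.
  have d0 : 0 < thin p k * (a / b) by rewrite mulr_gt0.
  have d1 : thin p k * (a / b) <= 1 by rewrite mulr_ile1 // ltW.
  have eta0 : 0 < eta by rewrite mulr_gt0 // powR_gt0.
  elim=> [|i IH] j ijk.
    exists 0%N, (nseq k false); rewrite size_nseq; split=> //.
    rewrite expr0 mulr1 mul0n mul1n -mulrA.
    have := (bil 0%N (nseq k false) (4 ^ j)%N (nseq k false)).1.
    by rewrite ell1_dist_line // size_nseq subn0.
  have jk : (j < k)%N by rewrite -ijk addSn ltnS leq_addl.
  have [|n [eps [szk big]]] := IH j.+1; first by rewrite -ijk addnS.
  apply: contrapT => noedge.
  set q : nat := (4 ^ j)%N.
  have q0 : 0 < q%:R :> R by rewrite ltr0n expn_gt0.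
  set L := a * (1 + thin p k) * q%:R * (1 + eta) ^+ i.+1.
  have t10 : 0 < 1 + thin p k by lra.
  have L0 : 0 < L by rewrite !mulr_gt0 // exprn_gt0 //; lra.
  (* The bound [L] expresses that no sub-edge is stretched enough; the upper Lipschitz bound keeps
     [l] small enough for the diagonal to be at least thin * (a / b) * l. *)
  pose l := Num.min L (b * ((1 + thin p k) * q%:R)).
  have l0 : 0 < l by rewrite lt_min L0 !mulr_gt0.
  have edge n' del : size del = k -> rho (f (n' * q)%N del) (f (n'.+1 * q)%N del) <= l.
    move=> sd; rewrite le_min; apply/andP; split.
      rewrite leNgt; apply/negP => Lrho; apply: noedge; exists n', del; split => //.
      exact: ltW.
    have := (bil (n' * q)%N del (n'.+1 * q)%N del).2.
    by rewrite ell1_dist_line ?leq_mul2r ?leqnSn ?orbT // sd -mulnBl subSnn mul1n.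
  have je : (j < size eps)%N by rewrite szk.
  have sf : size (flip j eps) = k by rewrite size_flip.
  (* The graph vertices are at (4 n + c) q for c = 0, ..., 4: the branches of level [j] meet at c =
     1 and c = 3, and c = 2 is the peak of the tent. *)
  have tq c : tent j ((4 * n + c) * q) = (q * tent 0 (4 * n + c))%N.
    by rewrite mulnC -[in LHS](addn0 j) tent_pow.
  have E c : tent 0 (4 * n + c) = 0%N -> f ((4 * n + c) * q)%N (flip j eps) = f ((4 * n + c) * q)%N eps.
    by move=> t0'; apply: fext; rewrite -(@ell1_pt_flip j) // tq t0' muln0.
  have := conv (f ((4 * n + 0) * q)%N eps) (f ((4 * n + 1) * q)%N eps)
     (f ((4 * n + 2) * q)%N eps) (f ((4 * n + 2) * q)%N (flip j eps))
     (f ((4 * n + 3) * q)%N eps) (f ((4 * n + 4) * q)%N eps)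
     (Df _ _) (Df _ _) (Df _ _) (Df _ _) (Df _ _) (Df _ _) l _ l0 d0 d1.
  rewrite -/eta => H.
  have {}H : rho (f ((4 * n + 0) * q)%N eps) (f ((4 * n + 4) * q)%N eps) <= 4 * l * (1 - eta).
    apply: H; rewrite ?addn0.
    - by rewrite addn1; exact: edge.
    - by rewrite addn1 addn2; exact: edge.
    - by rewrite addn2 addn3; exact: edge.
    - by rewrite -(E 1%N) /=; [rewrite addn1 addn2; exact: edge | exact: tent_odd1].
    - by rewrite -(E 3%N) /=; [rewrite addn2 addn3; exact: edge | exact: tent_odd3].
    - by rewrite addn3 addn4; exact: edge.
    (* The diagonal has length at least 2 thin q in the wedge, and 1 + thin <= 2. *)
    apply: le_trans (bil _ _ _ _).1; apply: (@le_trans _ _ (a * (thin p k * (2 * q%:R)))); last first.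
      rewrite ler_pM2l //; have := ell1_dist_flip ((4 * n + 2) * q)%N je.
      have t2 := tent_mid n.
      by rewrite tq t2 muln1 szk.
    apply: (@le_trans _ _ (thin p k * (a / b) * (b * ((1 + thin p k) * q%:R)))).
      by rewrite ler_pM2l // ge_min lexx orbT.
    have -> : thin p k * (a / b) * (b * ((1 + thin p k) * q%:R)) =
      a * (thin p k * ((1 + thin p k) * q%:R)) by field; rewrite gt_eqF.
    rewrite !ler_pM2l // ler_pM2r //; lra.
  have lL : l <= L by rewrite ge_min lexx.
  move: big; rewrite leNgt => /negP; apply.
  have -> : (n * 4 ^ j.+1 = (4 * n + 0) * q)%N by rewrite addn0 expnS mulnA [(n * 4)%N]mulnC.
  have -> : (n.+1 * 4 ^ j.+1 = (4 * n + 4) * q)%N by rewrite expnS mulnA [(n.+1 * 4)%N]mulnC mulnS addnC.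
  apply: (le_lt_trans H).
  have LE : a * (1 + thin p k) * (4 ^ j.+1)%:R * (1 + eta) ^+ i * (1 + eta) = 4 * L.
    by rewrite /L exprS expnS natrM -/q; ring.
  have X0 : 0 < a * (1 + thin p k) * (4 ^ j.+1)%:R * (1 + eta) ^+ i.
    by rewrite !mulr_gt0 ?ltr0n ?expn_gt0 // exprn_gt0 //; lra.
  move: LE X0; set X := _ * _ ^+ i => LE X0.
  (* Since 4 L = X (1 + eta), the stretch is at most X (1 - eta^2) < X when eta <= 1; otherwise its
     upper bound is negative. *)
  have [e1|e1] := leP eta 1.
    apply: (@le_lt_trans _ _ (4 * L * (1 - eta))).
      by rewrite ler_wpM2r ?subr_ge0 // ler_pM2l.
    have -> : 4 * L * (1 - eta) = X - X * (eta * eta) by rewrite -LE; ring.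
    by rewrite ltrBlDr ltrDl; apply: mulr_gt0 X0 _; exact: mulr_gt0.
  apply: lt_trans X0; have : 0 < 4 * l by rewrite mulr_gt0.
  by move=> l40; rewrite pmulr_rlt0 // subr_lt0.
(* The total gain k * (thin k)^s grows like k^(1 - s/p), with a positive exponent. *)
pose al := 1 - s / p.
have al0 : 0 < al by rewrite subr_gt0 ltr_pdivrMr // mul1r.
(* Bernoulli turns a (1 + eta)^k <= b into a k eta <= b; the factor 2 absorbs k + 1 <= 2 k. *)
pose K := 2 * b / (a * (C * (a / b) `^ s)).
have c0 : 0 < C * (a / b) `^ s by rewrite mulr_gt0 // powR_gt0 // divr_gt0.
have K0 : 0 < K by rewrite !mulr_gt0 // invr_gt0 mulr_gt0.
have bound k : (0 < k)%N -> k.+1%:R `^ al <= K.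
  move=> k0; have [n [eps [sz le]]] := growth k k 0%N (addn0 k).
  have := (bil (n * 4 ^ 0)%N eps (n.+1 * 4 ^ 0)%N eps).2.
  rewrite ell1_dist_line ?leq_mul2r ?leqnSn ?orbT // !muln1 subSnn mulr1 sz => ub.
  rewrite !muln1 mulr1 in le.
  have t10 : 0 < 1 + thin p k by have := thin_gt0 p k; lra.
  have := le_trans le ub.
  set eta := C * _.
  have eta0 : 0 <= eta by rewrite mulr_ge0 ?powR_ge0 // ltW.
  rewrite mulrAC ler_pM2r // => le'.
  have bern := bernoulli_le k eta0.
  have keta : a * (k%:R * eta) <= b.
    apply: le_trans le'; rewrite ler_pM2l //; apply: le_trans bern; lra.
  have etaE : eta = (C * (a / b) `^ s) * k.+1%:R `^ (al - 1).
    rewrite /eta powRM ?(ltW (thin_gt0 _ _)) ?divr_ge0 // ?(ltW a0) ?(ltW b0) //.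
    rewrite mulrA mulrAC; congr (_ * _ * _).
      rewrite /thin -powRrM; congr (_ `^ _); rewrite /al; field.
      by rewrite gt_eqF.
  have kE : k.+1%:R `^ al = k.+1%:R * k.+1%:R `^ (al - 1) :> R.
    by rewrite mulr_powRB1.
  rewrite kE /K ler_pdivlMr; last exact: mulr_gt0.
  have k2 : k.+1%:R <= 2 * k%:R :> R.
    by rewrite -natrM ler_nat mul2n -addnn -addn1 leq_add2l.
  move: keta; rewrite etaE.
  have := powR_gt0 (al - 1) (ltr0Sn R k).
  move: (_ `^ (al - 1)) c0 => x; move: (C * _) => c c0 x0 keta.
  have acx : 0 <= a * c * x by rewrite !mulr_ge0 // ltW.
  have := ler_wpM2r acx k2; move: keta; move: k.+1%:R k%:R => y z; nra.
pose k := (Num.truncn (K `^ al^-1)).+1.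
have := bound k isT; rewrite leNgt => /negP; apply.
rewrite -[ltLHS](powRVKr (ltW K0) (lt0r_neq0 al0)).
apply: gt0_ltr_powR => //; rewrite ?nnegrE ?powR_ge0 //.
apply: lt_trans (truncnS_gt _) _.
by rewrite ltr_nat.
Qed.

End NonEmbedding.

(** * Uniformly convex normed spaces satisfy the quadrilateral condition *)

Section UniformConvexity.
Variables (R : realType) (X : normedModType R) (q C : R).
Hypotheses (q1 : 1 <= q) (C0 : 0 < C).
Hypothesis convX : forall x y : X, `|x| = 1 -> `|y| = 1 ->
  `|x + y| <= 2 - C * (`|x - y| `^ q).

(** Both norms exceed l (1 - 2 k), so replacing [x] and [y] by vectors of norm exactly [l] in the
    same directions costs at most 4 k l. The unit directions then satisfy |e + f| > 2 - 6 k, and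
    convexity bounds their difference. *)
Lemma unif_convex_ball (x y : X) (l k : R) : 0 < l -> k <= 4^-1 ->
  `|x| <= l -> `|y| <= l -> 2 * l * (1 - k) < `|x + y| ->
  exists e : R, [/\ 0 <= e, C * e `^ q <= 6 * k & `|x - y| <= l * (e + 4 * k)].
Proof.
move=> l0 k4 xl yl xy.
have nD := ler_normD x y.
have x0 : 0 < `|x| by nra.
have y0 : 0 < `|y| by nra.
have unit (z : X) : 0 < `|z| -> exists2 e : X, `|e| = 1 & z = `|z| *: e.
  move=> z0; exists (`|z|^-1 *: z); first by rewrite normrZ normfV normr_id mulVf ?gt_eqF.
  by rewrite scalerA divff ?gt_eqF // scale1r.
have [e ne xe] := unit x x0; have [f nf yf] := unit y y0.
have bnd (sgn : R) : `|sgn| = 1 -> `|(l *: e + sgn *: (l *: f)) - (x + sgn *: y)| <= 4 * k * l.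
  move=> s1; rewrite {1}xe {1}yf.
  have -> : (l *: e + sgn *: (l *: f)) - (`|x| *: e + sgn *: (`|y| *: f)) =
     (l - `|x|) *: e + sgn *: ((l - `|y|) *: f).
    by rewrite !scalerBl scalerBr opprD addrACA.
  apply: (le_trans (ler_normD _ _)); rewrite !normrZ s1 ne nf mul1r !mulr1.
  by rewrite !ger0_norm ?subr_ge0 //; nra.
have bp := bnd 1 (normr1 _); have bm := bnd (-1) (normrN1 _).
rewrite !scale1r in bp; rewrite !scaleN1r in bm.
have ep : l * `|e + f| = `|l *: e + l *: f| by rewrite -scalerDr normrZ gtr0_norm.
have em : l * `|e - f| = `|l *: e - l *: f| by rewrite -scalerBr normrZ gtr0_norm.
exists `|e - f|; split => //.
  have := convX ne nf; have := ler_distD (l *: e + l *: f) 0 (x + y).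
  rewrite !sub0r !normrN -ep => h1 h2.
  have : l * (2 - 6 * k) < l * `|e + f| by nra.
  by rewrite ltr_pM2l //; lra.
have := ler_distD (l *: e - l *: f) 0 (x - y).
rewrite !sub0r !normrN -em => h1; rewrite mulrDr; nra.
Qed.

(** If |a - b| were almost 2 l, both [m] and [m'] would be near the midpoint of [a] and [b], hence
    too close to each other. So [a] to [b] is shortened by the factor 1 - k, and the whole path,
    twice as long, by 1 - k / 2. *)
Lemma unif_convex_laakso : laakso_convex (fun _ : X => True) (fun x y => `|x - y|) q.
Proof.
have q0 : 0 <= q by rewrite (le_trans _ q1).
(* The first bound gives k <= d / 16, the second forces the errors [e] and [e'] below d / 2; then 2
   d <= e + e' + 8 k <= 3 d / 2 is absurd. *)
pose c := Num.min 16^-1 (C / (6 * 2 `^ q)).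
have tq0 : 0 < 2 `^ q :> R by exact: powR_gt0.
have c0 : 0 < c by rewrite lt_min invr_gt0 ltr0n divr_gt0 // mulr_gt0.
exists (c / 2); first by rewrite divr_gt0.
move=> u a m m' b v _ _ _ _ _ _ l d l0 d0 d1 ua am mb am' m'b bv dl.
pose k := c * d `^ q.
have dq0 : 0 < d `^ q by exact: powR_gt0.
have dqd : d `^ q <= d by rewrite ge1r_powR // d0.
have c8 : c <= 16^-1 by rewrite ge_min lexx.
have k0 : 0 < k by rewrite mulr_gt0.
have kd : k <= 16^-1 * d by rewrite /k; nra.
have k6 : 6 * k * 2 `^ q <= C * d `^ q.
  have : c <= C / (6 * 2 `^ q) by rewrite ge_min lexx orbT.
  rewrite ler_pdivlMr ?mulr_gt0 // => h.
  by have := ler_wpM2r (ltW dq0) h; rewrite /k; lra.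
suff ab : `|a - b| <= 2 * l * (1 - k).
  have := ler_distD a u v; have := ler_distD b a v.
  have -> : 4 * l * (1 - c / 2 * d `^ q) = 4 * l - 2 * (l * k) by rewrite /k; field.
  by move: ab; rewrite mulrBr mulr1 -mulrA; lra.
rewrite leNgt; apply/negP => abk.
have k4 : k <= 4^-1 by lra.
have E n : (a - n) + (n - b) = a - b by rewrite addrA subrK.
have [e [e0 eq em]] : exists e : R, [/\ 0 <= e, C * e `^ q <= 6 * k & `|(a - m) - (m - b)| <= l * (e + 4 * k)].
  by apply: unif_convex_ball; rewrite ?E.
have [e' [e0' eq' em']] : exists e : R, [/\ 0 <= e, C * e `^ q <= 6 * k & `|(a - m') - (m' - b)| <= l * (e + 4 * k)].
  by apply: unif_convex_ball; rewrite ?E.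
have small (x : R) : 0 <= x -> C * x `^ q <= 6 * k -> x <= d / 2.
  move=> x0 xq; rewrite leNgt; apply/negP => dx.
  have : (d / 2) `^ q < x `^ q.
    apply: gt0_ltr_powR => //; rewrite ?nnegrE ?divr_ge0 ?(ltW d0) //.
    by rewrite (lt_le_trans _ q1).
  rewrite powRM ?(ltW d0) // ?invr_ge0 // => lt.
  have : 2 `^ q * (d `^ q * 2^-1 `^ q) < 2 `^ q * x `^ q by rewrite ltr_pM2l.
  have t2 : 2 `^ q * 2^-1 `^ q = 1 :> R.
    by rewrite -powRM ?invr_ge0 // mulfV ?powR1 // pnatr_eq0.
  rewrite mulrCA t2 mulr1 => lt2.
  have : C * d `^ q < C * (2 `^ q * x `^ q) by rewrite ltr_pM2l.
  by have := ler_wpM2r (ltW tq0) xq; lra.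
have := small e e0 eq; have := small e' e0' eq'.
have := ler_normB ((a - m') - (m' - b)) ((a - m) - (m - b)).
have -> : ((a - m') - (m' - b)) - ((a - m) - (m - b)) = 2 *: (m - m').
  have F n : (a - n) - (n - b) = (a + b) - (n + n) by rewrite opprB addrACA -opprD.
  by rewrite !F opprB addrC addrA subrK scaler_nat mulr2n addrACA -opprD.
rewrite normrZ ger0_norm // => tri h1 h2.
have : l * (2 * d) <= l * (e' + 4 * k + (e + 4 * k)) by rewrite mulrDr; lra.
by rewrite ler_pM2l // => h3; lra.
Qed.

End UniformConvexity.

(** * Uniform convexity of L_q *)

Section TwoPoint.
Variable R : realType.
Implicit Types (x y q : R).

(* Young's inequality for [x] and [1]. *)
Lemma bernoulli_powR q x : 1 < q -> 0 <= x -> 1 + q * (x - 1) <= x `^ q.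
Proof.
move=> q1 x0; have q0 : 0 < q by rewrite (lt_trans _ q1).
have qn0 : q != 0 by rewrite gt_eqF.
have q10 : q - 1 != 0 by rewrite gt_eqF // subr_gt0.
have := @conjugate_powR _ x 1 q (q / (q - 1)) x0 ler01 q0.
rewrite divr_gt0 // ?subr_gt0 // powR1 mulr1 => /(_ isT).
have -> : q^-1 + (q / (q - 1))^-1 = 1 by field; rewrite qn0 q10.
have -> : (q / (q - 1))^-1 = 1 - q^-1 by field; rewrite qn0 q10.
move=> /(_ erefl); rewrite mul1r -(ler_pM2l q0).
have -> : q * (x `^ q / q + (1 - q^-1)) = x `^ q + q - 1 by field.
by lra.
Qed.

Lemma powR_tangent q x y : 1 < q -> 0 <= x -> 0 < y ->
  y `^ q + q * y `^ (q - 1) * (x - y) <= x `^ q.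
Proof.
move=> q1 x0 y0; have yn0 : y != 0 by rewrite gt_eqF.
have := @bernoulli_powR q (x / y) q1 (divr_ge0 x0 (ltW y0)).
rewrite -(ler_pM2r (powR_gt0 q y0)) -powRM ?divr_ge0 // ?(ltW y0) // divfK //.
rewrite -[y `^ q](mulr_powRB1 (ltW y0) (lt_trans ltr01 q1)).
by congr (_ <= _); field.
Qed.

(** The tangent inequalities at the midpoint are added; the linear terms cancel. *)
Lemma powR_midpoint q x y : 1 < q -> 0 <= x -> 0 <= y ->
  2 * ((x + y) / 2) `^ q <= x `^ q + y `^ q.
Proof.
move=> q1 x0 y0; have [m0|] := ltP 0 ((x + y) / 2).
  have := powR_tangent q1 x0 m0; have := powR_tangent q1 y0 m0.
  set m := (x + y) / 2; set t := q * _.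
  have -> : y - m = - (x - m) by rewrite /m; field.
  by rewrite mulrN; lra.
move=> m0; have [-> ->] : x = 0 /\ y = 0 by split; lra.
by rewrite addr0 mul0r powR0 ?gt_eqF ?(lt_trans _ q1) //; lra.
Qed.

Lemma powR_norm_midpoint q x y : 1 < q ->
  2 * `|(x + y) / 2| `^ q <= `|x| `^ q + `|y| `^ q.
Proof.
move=> q1; apply: le_trans (powR_midpoint q1 (normr_ge0 x) (normr_ge0 y)).
rewrite ler_wpM2l //; apply: powR_le2 => //; first by rewrite (le_trans ler01 (ltW q1)).
by rewrite normrM [`|2^-1|]gtr0_norm // ler_wpM2r // ler_normD.
Qed.

(* Squaring Bernoulli's inequality for [sqrt (1 + x)] keeps a quadratic term. *)
Lemma powR_1Dx q x : 1 < q -> 0 <= x -> x <= 1 ->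
  1 + q * x + (q - 1) * x ^+ 2 / 8 <= (1 + x) `^ q.
Proof.
move=> q1 x0 x1; set y := Num.sqrt (1 + x).
have y2 : y ^+ 2 = 1 + x by rewrite sqr_sqrtr //; lra.
have y1 : 1 <= y by rewrite -sqrtr1 ler_sqrt; lra.
have yu : y <= 3 / 2 by nra.
have B := @bernoulli_powR q y q1 (le_trans ler01 y1).
have -> : (1 + x) `^ q = (y `^ q) ^+ 2.
  by rewrite -y2 -(powR_mulrn 2 (le_trans ler01 y1)) powRAC powR_mulrn ?powR_ge0.
have B0 : 0 <= 1 + q * (y - 1) by nra.
apply: (@le_trans _ _ ((1 + q * (y - 1)) ^+ 2)); last by rewrite ler_sqr ?nnegrE ?powR_ge0.
have -> : x = y ^+ 2 - 1 by rewrite y2; lra.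
have -> : (1 + q * (y - 1)) ^+ 2 = 1 + q * (y ^+ 2 - 1) + (q - 1) * (y - 1) ^+ 2 * q by ring.
rewrite lerD2l.
have -> : (y ^+ 2 - 1) ^+ 2 = (y - 1) ^+ 2 * (y + 1) ^+ 2 by ring.
have h : (y + 1) ^+ 2 <= 25 / 4 by nra.
have A0 : 0 <= (q - 1) * (y - 1) ^+ 2 by rewrite mulr_ge0 ?sqr_ge0 //; lra.
have -> : (q - 1) * ((y - 1) ^+ 2 * (y + 1) ^+ 2) / 8 =
  (q - 1) * (y - 1) ^+ 2 * ((y + 1) ^+ 2 / 8) by field.
by rewrite ler_wpM2l //; lra.
Qed.

(* A two-point form of uniform convexity; [K] and [L] are the gain and the loss. *)
Definition two_point_convex q (K L : R) := forall x y : R,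
  2 * `|(x + y) / 2| `^ q + K * `|x - y| `^ q <= (1 + L) * (`|x| `^ q + `|y| `^ q).

(** Clarkson's inequality: superadditivity and convexity of t^(q/2), with the parallelogram identity
    in between. *)
Lemma two_point_ge2 q : 2 <= q -> two_point_convex q (2 * (2 `^ q)^-1) 0.
Proof.
move=> q2 x y; rewrite addr0 mul1r.
have q0 : 0 <= q by lra.
pose s := (q / 2 : R).
have s1 : 1 <= s by rewrite /s; lra.
have sq (z : R) : `|z| `^ q = (z ^+ 2) `^ s.
  by rewrite -real_normK ?num_real // -powR_mulrn // -powRrM /s mulrC divfK.
have -> : 2 * (2 `^ q)^-1 * `|x - y| `^ q = 2 * `|(x - y) / 2| `^ q.
  rewrite normrM [`|2^-1|]gtr0_norm // powRM // -mulrA [_^-1 * _]mulrC; congr (_ * (_ * _)).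
  by rewrite -[2^-1 in RHS]powR_inv1 // -powRrM mulN1r powRN.
rewrite !sq -mulrDr.
have := powR_superadd s1 (sqr_ge0 ((x + y) / 2)) (sqr_ge0 ((x - y) / 2)).
have -> : ((x + y) / 2) ^+ 2 + ((x - y) / 2) ^+ 2 = (x ^+ 2 + y ^+ 2) / 2 by field.
move=> h; apply: (@le_trans _ _ (2 * ((x ^+ 2 + y ^+ 2) / 2) `^ s)); first by rewrite ler_pM2l.
move: s1; rewrite le_eqVlt => /orP[/eqP <-|s1].
  by rewrite !powRr1 ?divr_ge0 ?addr_ge0 ?sqr_ge0 //; lra.
by apply: powR_midpoint => //; exact: sqr_ge0.
Qed.

(** For q <= 2 the gain is quadratic in [h], weighted by a power of the larger of [m] and [h].
    Dividing by the larger one leaves a one-variable inequality on [0, 1]. *)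
Let core q : 1 < q -> q <= 2 -> exists2 c : R, 0 < c & forall m h : R, 0 <= m -> 0 <= h ->
  2 * m `^ q + c * h ^+ 2 * Num.max m h `^ (q - 2) <= (m + h) `^ q + `|m - h| `^ q.
Proof.
move=> q1 q2; pose c := (q - 1) / 8.
have c0 : 0 < c by rewrite /c; lra.
have qq0 : 0 < q by lra.
have base z : 0 <= z -> z <= 1 -> 2 + c * z ^+ 2 <= (1 + z) `^ q + (1 - z) `^ q.
  move=> z0 z1; have := powR_1Dx q1 z0 z1.
  have := @bernoulli_powR q (1 - z) q1; rewrite subr_ge0 => /(_ z1).
  by rewrite /c; lra.
exists (c / 4); first by lra.
move=> m h m0 h0; have [hm|mh] := leP h m.
  move: m0; rewrite le_eqVlt => /orP[/eqP mE|m0].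
    have -> : h = 0 by lra.
    by rewrite -mE expr0n /= mulr0 mul0r !addr0 subrr normr0 powR0 ?gt_eqF // mulr0 addr0.
  have z0 : 0 <= h / m by rewrite divr_ge0 // ltW.
  have z1 : h / m <= 1 by rewrite ler_pdivrMr // mul1r.
  have := ler_wpM2r (powR_ge0 m q) (base _ z0 z1).
  rewrite mulrDl [X in _ <= X]mulrDl -!powRM ?subr_ge0 ?addr_ge0 ?(ltW m0) //.
  have -> : (1 + h / m) * m = m + h by field; rewrite gt_eqF.
  have -> : (1 - h / m) * m = m - h by field; rewrite gt_eqF.
  rewrite ger0_norm ?subr_ge0 //; apply: le_trans; rewrite lerD2l.
  have -> : c * (h / m) ^+ 2 * m `^ q = c * h ^+ 2 * m `^ (q - 2).
    rewrite powRB; last by rewrite (gt_eqF m0) implybT.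
    rewrite powR_mulrn ?(ltW m0) //; field; rewrite gt_eqF //.
  by rewrite -[leLHS]mulrA -[leRHS]mulrA ler_wpM2r ?mulr_ge0 ?powR_ge0 ?sqr_ge0 //; lra.
have {}h0 : 0 < h by rewrite (le_lt_trans m0).
have w0 : 0 <= m / h by rewrite divr_ge0 // ltW.
have w1 : m / h <= 1 by rewrite ler_pdivrMr // mul1r ltW.
(* For w <= 1/2 there is room to spare, since 2 w^q <= 1; for w > 1/2 the quadratic term is at least
   c / 4. *)
have key : 2 * (m / h) `^ q + c / 4 <= (1 + m / h) `^ q + (1 - m / h) `^ q.
  move: (m / h) w0 w1 => w w0 w1; have [w2|w2] := leP w 2^-1.
    have := base _ w0 w1; have : w `^ q <= w.
      move: w0; rewrite le_eqVlt => /orP[/eqP <-|w0]; first by rewrite powR0 ?gt_eqF.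
      by rewrite ge1r_powR // ?w0 // ltW.
    have : 0 <= c * w ^+ 2 by rewrite mulr_ge0 ?sqr_ge0 // ltW.
    have : c / 4 <= 1 by rewrite /c; lra.
    by lra.
  have := base _ w0 w1; have : w `^ q <= 1.
    by have := powR_le2 (ltW qq0) w0 w1; rewrite powR1.
  have : 4^-1 <= w ^+ 2 by nra.
  by move=> h1 h2 h3; have := ler_wpM2l (ltW c0) h1; lra.
have := ler_wpM2r (powR_ge0 h q) key.
have -> : (2 * (m / h) `^ q + c / 4) * h `^ q = 2 * m `^ q + c / 4 * h `^ q.
  by rewrite mulrDl -[2 * _ * _]mulrA -powRM ?(ltW h0) // divfK // gt_eqF.
rewrite [X in _ <= X]mulrDl -!powRM ?subr_ge0 ?addr_ge0 ?(ltW h0) //.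
have -> : (1 + m / h) * h = m + h by field; rewrite gt_eqF.
have -> : (1 - m / h) * h = h - m by field; rewrite gt_eqF.
rewrite distrC ger0_norm ?subr_ge0 ?(ltW mh) //.
rewrite (_ : c / 4 * h `^ q = c / 4 * h ^+ 2 * h `^ (q - 2)) //.
rewrite powRB; last by rewrite (gt_eqF h0) implybT.
by rewrite powR_mulrn ?(ltW h0) //; field; rewrite gt_eqF.
Qed.

(** The quadratic gain of [core] is exchanged for a q-th power gain at the price of a loss of order
    eta^2; the parameter is later tied to the length of the diagonal. *)
Lemma two_point_lt2 q : 1 < q -> q <= 2 -> exists2 c : R, 0 < c &
  forall eta : R, 0 < eta ->
    two_point_convex q (c * eta `^ (2 - q)) (4 * c * eta ^+ 2).
Proof.
move=> q1 q2; have [c c0 H] := core q1 q2.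
exists (c / 4); first by lra.
move=> eta eta0 x y.
have qq0 : 0 <= q by lra.
pose m := `|(x + y) / 2|; pose h := `|(x - y) / 2|; pose M := Num.max m h.
have S0 : 0 <= `|x| `^ q + `|y| `^ q by rewrite addr_ge0 ?powR_ge0.
have e20 : 0 <= eta ^+ 2 by rewrite sqr_ge0.
(* Up to order, [m + h] and [|m - h|] are [|x|] and [|y|]. *)
have mh : (m + h) `^ q + `|m - h| `^ q = `|x| `^ q + `|y| `^ q.
  have -> : `|x| = `|(x + y) / 2 + (x - y) / 2| by congr `|_|; field.
  have -> : `|y| = `|(x + y) / 2 - (x - y) / 2| by congr `|_|; field.
  rewrite /m /h; move: ((x + y) / 2) ((x - y) / 2) => a b.
  wlog a0 : a b / 0 <= a.
    move=> W; have [/W//|a0] := leP 0 a.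
    have := W (- a) (- b); rewrite !normrN => -> //; last by rewrite oppr_ge0 ltW.
    by rewrite -!opprD !normrN.
  have [b0|b0] := leP 0 b.
    by rewrite (ger0_norm a0) (ger0_norm b0) (ger0_norm (addr_ge0 a0 b0)).
  rewrite (ger0_norm a0) (ltr0_norm b0) opprK addrC; congr (_ + _).
  by rewrite ger0_norm // addr_ge0 // oppr_ge0 ltW.
have hxy : `|x - y| = 2 * h by rewrite /h normrM [`|2^-1|]gtr0_norm //; field.
have m0 : 0 <= m by exact: normr_ge0.
have h0 : 0 <= h by exact: normr_ge0.
have M0 : 0 <= M by rewrite le_max m0.
have := H m h m0 h0; rewrite mh -/M -/m => Hm.
have MS : M `^ q <= `|x| `^ q + `|y| `^ q.
  have mS : m `^ q <= `|x| `^ q + `|y| `^ q.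
    by have := powR_norm_midpoint x y q1; rewrite -/m; have := powR_ge0 m q; lra.
  have hS : h `^ q <= `|x| `^ q + `|y| `^ q.
    by have := powR_norm_midpoint x (- y) q1; rewrite normrN -/h; have := powR_ge0 h q; lra.
  by rewrite /M; case: (leP m h).
(* Either [h <= eta M], or [M] can be traded for [h / eta]. *)
suff split : eta `^ (2 - q) * h `^ q <= eta ^+ 2 * M `^ q + h ^+ 2 * M `^ (q - 2).
  have -> : `|x - y| `^ q = 2 `^ q * h `^ q by rewrite hxy powRM.
  have tq : 2 `^ q <= 4 :> R.
    by have -> : 4 = 2 `^ 2 :> R; [rewrite powR_mulrn // -natrX | apply: ler_powR; rewrite ?ler1n].
  have eh0 : 0 <= eta `^ (2 - q) * h `^ q by rewrite mulr_ge0 ?powR_ge0.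
  have : c / 4 * eta `^ (2 - q) * (2 `^ q * h `^ q) <= c * (eta `^ (2 - q) * h `^ q).
    rewrite (_ : c / 4 * _ * _ = c / 4 * (eta `^ (2 - q) * h `^ q) * 2 `^ q); last by ring.
    rewrite (_ : c * (_ * _) = c / 4 * (eta `^ (2 - q) * h `^ q) * 4); last by field.
    by rewrite ler_wpM2l // mulr_ge0 //; lra.
  have := ler_wpM2l (ltW c0) split; have := ler_wpM2l e20 MS.
  move=> h1; have := ler_wpM2l (ltW c0) h1.
  have -> : (1 + 4 * (c / 4) * eta ^+ 2) * (`|x| `^ q + `|y| `^ q) =
    `|x| `^ q + `|y| `^ q + c * (eta ^+ 2 * (`|x| `^ q + `|y| `^ q)) by field.
  rewrite -/m; move: Hm; rewrite -[c * h ^+ 2 * _]mulrA [c * (_ + _)]mulrDr.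
  by lra.
have [hM|Mh] := leP h (eta * M).
  apply: (@le_trans _ _ (eta ^+ 2 * M `^ q)); last by rewrite lerDl mulr_ge0 ?powR_ge0 ?sqr_ge0.
  have : h `^ q <= eta `^ q * M `^ q by rewrite -powRM ?(ltW eta0) //; apply: powR_le2.
  move=> /(ler_wpM2l (powR_ge0 eta (2 - q))); rewrite mulrA -powRD ?subrK ?powR_mulrn ?(ltW eta0) //.
  by rewrite (gt_eqF eta0) implybT.
apply: (@le_trans _ _ (h ^+ 2 * M `^ (q - 2))); last by rewrite lerDr mulr_ge0 ?powR_ge0.
have {}h0 : 0 < h by rewrite (le_lt_trans _ Mh) // mulr_ge0 // ltW.
have {}M0 : 0 < M by rewrite lt_max h0 orbT.
have -> : h ^+ 2 * M `^ (q - 2) = h `^ q * (h / M) `^ (2 - q).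
  rewrite powRM ?invr_ge0 ?(ltW h0) ?(ltW M0) // mulrA -powRD; last by rewrite (gt_eqF h0) implybT.
  rewrite addrCA subrr addr0 powR_mulrn ?(ltW h0) //; congr (_ * _).
  by rewrite -[M^-1]powR_inv1 ?(ltW M0) // -powRrM mulN1r opprB.
rewrite mulrC ler_wpM2l ?powR_ge0 //; apply: powR_le2; rewrite ?subr_ge0 ?(ltW eta0) //.
by rewrite ler_pdivlMr // ltW.
Qed.

End TwoPoint.

(** * From pointwise inequalities to the quadrilateral condition in L_q *)

Section LqSpace.
Variable R : realType.
Implicit Types (q s : R) (g h : R -> R).

Let I01 : set R := `[0%R, 1%R]%classic.

Let mI01 : measurable (I01 : set (measurableTypeR R)). Proof. exact: measurable_itv. Qed.

Definition Lq_energy q g h : R :=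
  Rintegral (@lebesgue_measure R) I01 (fun x => `|g x - h x| `^ q).

Let measurable_energy q g : measurable_fun I01 g ->
  measurable_fun I01 (fun x => `|g x| `^ q).
Proof.
move=> mg; apply: (@measurableT_comp _ _ _ _ _ _ (@powR R ^~ q)) => //.
exact: measurableT_comp.
Qed.

Let in_Lq_integrable q g : in_Lq q g ->
  (@lebesgue_measure R).-integrable I01 (EFin \o (fun x => `|g x| `^ q)).
Proof.
move=> [mg fg]; apply/integrableP; split.
  by apply/measurable_EFinP; exact: measurable_energy.
apply: le_lt_trans fg; rewrite le_eqVlt; apply/orP; left; apply/eqP.
by apply: eq_integral => x _ /=; rewrite ger0_norm // powR_ge0.
Qed.

Lemma Lq_energy_integrable q g h : 0 <= q -> in_Lq q g -> in_Lq q h ->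
  (@lebesgue_measure R).-integrable I01 (EFin \o (fun x => `|g x - h x| `^ q)).
Proof.
move=> q0 Lg Lh; have ig := in_Lq_integrable Lg; have ih := in_Lq_integrable Lh.
have [[mg _] [mh _]] := (Lg, Lh).
have iZ := integrableZl mI01 (2 `^ q) (integrableD mI01 ig ih).
apply: (le_integrable mI01 _ _ iZ).
  apply/measurable_EFinP; apply: (@measurable_energy q (fun x => g x - h x)).
  exact: measurable_funB.
move=> x _ /=; rewrite lee_fin [leLHS]ger0_norm ?powR_ge0 // [leRHS]ger0_norm; last first.
  by rewrite mulr_ge0 ?addr_ge0 ?powR_ge0.
apply: le_trans (powRD_le q0 (normr_ge0 _) (normr_ge0 _)).
by apply: powR_le2 => //; exact: ler_normB.
Qed.

(** Integrates any linear inequality between q-th powers of differences; each entry of [s] is a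
    coefficient with a pair of indices into [G]. *)
Lemma Lq_energy_lincomb q (G : nat -> R -> R) (s : seq (R * (nat * nat))) :
  0 <= q -> (forall i, in_Lq q (G i)) ->
  (forall y : nat -> R, 0 <= \sum_(e <- s) e.1 * `|y e.2.1 - y e.2.2| `^ q) ->
  0 <= \sum_(e <- s) e.1 * Lq_energy q (G e.2.1) (G e.2.2).
Proof.
move=> q0 LG ge0.
pose F (x : R) := \sum_(e <- s) e.1 * `|G e.2.1 x - G e.2.2 x| `^ q.
suff [_ <-] : (@lebesgue_measure R).-integrable I01 (EFin \o F) /\
   Rintegral (@lebesgue_measure R) I01 F = \sum_(e <- s) e.1 * Lq_energy q (G e.2.1) (G e.2.2).
  by apply: Rintegral_ge0 => x _; exact: (ge0 (fun i => G i x)).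
rewrite /F {ge0 F}; elim: s => [|e s [iF IH]].
  under [X in EFin \o X]eq_fun do rewrite big_nil.
  rewrite big_nil; split; first exact: integrable0.
  under eq_Rintegral do rewrite big_nil.
  by rewrite /Rintegral integral0.
have ie := Lq_energy_integrable q0 (LG e.2.1) (LG e.2.2).
have iZ := integrableZl mI01 e.1 ie.
under [X in EFin \o X]eq_fun do rewrite big_cons.
split; first by have := integrableD mI01 iZ iF.
under eq_Rintegral do rewrite big_cons.
by rewrite RintegralD // RintegralZl // IH big_cons.
Qed.

(** The two-point inequality is applied to the halves of [a], [m], [b] and of [a], [m'], [b]. Half
    the difference of the two deviations (a - m') - (m' - b) and (a - m) - (m - b) is m - m' up to
    sign, so together they pay for the diagonal; midpoint convexity then adds the outer edges. *)
Lemma laakso_pointwise q (K L : R) (u a m m' b v : R) : 1 < q -> 0 <= K ->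
  two_point_convex q K L ->
  `|u - v| `^ q + 4 `^ q * (K / 4) * `|m - m'| `^ q <=
  4 `^ q / 4 * (`|u - a| `^ q + `|b - v| `^ q) + 4 `^ q * ((1 + L) / 8) *
   (`|a - m| `^ q + `|m - b| `^ q + `|a - m'| `^ q + `|m' - b| `^ q).
Proof.
move=> q1 K0 tp.
have t1 := tp (a - m) (m - b); have t2 := tp (a - m') (m' - b).
have c1 := powR_norm_midpoint ((a - m') - (m' - b)) (- ((a - m) - (m - b))) q1.
have c2 := powR_norm_midpoint (u - a) (b - v) q1.
have c3 := powR_norm_midpoint ((u - a + (b - v)) / 2) ((a - b) / 2) q1.
rewrite normrN in c1.
have E1 : (a - m' - (m' - b) - (a - m - (m - b))) / 2 = m - m' by field.
have E2 n : a - n + (n - b) = a - b by ring.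
have E3 : ((u - a + (b - v)) / 2 + (a - b) / 2) / 2 = (u - v) / 4 by field.
rewrite E1 in c1; rewrite E3 in c3; rewrite !E2 in t1 t2.
have E4 : `|u - v| `^ q = 4 `^ q * `|(u - v) / 4| `^ q.
  rewrite -powRM // normrM [`|4^-1|]gtr0_norm //; congr (_ `^ _).
  by field.
have E5 : 0 <= 4 `^ q :> R by exact: powR_ge0.
have c1K := ler_wpM2l K0 c1.
rewrite E4; move: t1 t2 c1K c2 c3 E5.
move: (4 `^ q) (`|(u - v) / 4| `^ q) (`|m - m'| `^ q) => V z w.
move: (`|u - a| `^ q) (`|b - v| `^ q) (`|(a - b) / 2| `^ q) => A B D.
move: (`|a - m| `^ q) (`|m - b| `^ q) (`|a - m'| `^ q) (`|m' - b| `^ q) => S1 S2 S3 S4.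
move: (`|a - m' - _| `^ q) (`|a - m - _| `^ q) (`|(u - a + _) / 2| `^ q) => P P' Q.
move=> t1 t2 c1K c2 c3 V0.
have key : z + K / 4 * w <= (A + B) / 4 + (1 + L) / 8 * (S1 + S2 + S3 + S4) by lra.
by have := ler_wpM2l V0 key; lra.
Qed.

Lemma Lq_energy_laakso q (K L : R) (u a m m' b v : R -> R) :
  1 < q -> 0 <= K -> two_point_convex q K L ->
  in_Lq q u -> in_Lq q a -> in_Lq q m -> in_Lq q m' -> in_Lq q b -> in_Lq q v ->
  Lq_energy q u v + 4 `^ q * (K / 4) * Lq_energy q m m' <=
  4 `^ q / 4 * (Lq_energy q u a + Lq_energy q b v) + 4 `^ q * ((1 + L) / 8) *
   (Lq_energy q a m + Lq_energy q m b + Lq_energy q a m' + Lq_energy q m' b).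
Proof.
move=> q1 K0 tp Lu La Lm Lm' Lb Lv.
have q0 : 0 <= q by rewrite (le_trans ler01) // ltW.
pose G := nth u [:: u; a; m; m'; b; v].
have LG i : in_Lq q (G i).
  case: i => [|[|[|[|[|[|i]]]]]];
    [exact: Lu|exact: La|exact: Lm|exact: Lm'|exact: Lb|exact: Lv|].
  by rewrite /G /= nth_nil; exact: Lu.
pose t1 : R := 4 `^ q / 4; pose t2 := 4 `^ q * ((1 + L) / 8).
have := @Lq_energy_lincomb q G [:: (-1, (0, 5)%N); (- (4 `^ q * (K / 4)), (2, 3)%N);
  (t1, (0, 1)%N); (t1, (4, 5)%N); (t2, (1, 2)%N); (t2, (2, 4)%N);
  (t2, (1, 3)%N); (t2, (3, 4)%N)] q0 LG.
rewrite !big_cons !big_nil /G /= -/t1 -/t2 {LG G Lu La Lm Lm' Lb Lv}.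
move: (Lq_energy q u v) (Lq_energy q m m') (Lq_energy q u a) (Lq_energy q b v)
  (Lq_energy q a m) (Lq_energy q m b) (Lq_energy q a m') (Lq_energy q m' b)
  => n1 n2 n3 n4 n5 n6 n7 n8 H.
suff : 0 <= -1 * n1 + (- (4 `^ q * (K / 4)) * n2 + (t1 * n3 + (t1 * n4 + (t2 * n5 +
  (t2 * n6 + (t2 * n7 + (t2 * n8 + 0))))))) by lra.
apply: H => y; rewrite !big_cons big_nil /=.
have := laakso_pointwise (y 0%N) (y 1%N) (y 2%N) (y 3%N) (y 4%N) (y 5%N) q1 K0 tp.
rewrite -/t1 -/t2; move: (4 `^ q * (K / 4)) t1 t2 => k1 k2 k3.
by move=> *; lra.
Qed.

Let bound_of_energies (V W K L D X n0 n1 n2 n3 n4 n5 n6 n7 : R) :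
  0 <= V -> 0 <= W -> 0 <= K -> 0 <= L ->
  n0 + V * (K / 4) * n1 <= V / 4 * (n2 + n3) + V * ((1 + L) / 8) * (n4 + n5 + n6 + n7) ->
  D * W <= n1 -> n2 <= W -> n3 <= W -> n4 <= W -> n5 <= W -> n6 <= W -> n7 <= W ->
  X <= K / 4 * D - L / 2 -> n0 <= V * W * (1 - X).
Proof.
move=> V0 W0 K0 L0 H mm e1 e2 e3 e4 e5 e6 gain.
have t10 : 0 <= V / 4 by rewrite divr_ge0.
have t20 : 0 <= V * ((1 + L) / 8) by rewrite mulr_ge0 //; lra.
have VK0 : 0 <= V * (K / 4) by rewrite mulr_ge0 //; lra.
have h1 := ler_wpM2l t10 (lerD e1 e2).
have h2 := ler_wpM2l t20 (lerD (lerD (lerD e3 e4) e5) e6).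
have h3 := ler_wpM2l VK0 mm.
have h4 := ler_wpM2l (mulr_ge0 V0 W0) gain.
have E : V * W - V * W * (K / 4 * D - L / 2) =
  V / 4 * (W + W) + V * ((1 + L) / 8) * (W + W + W + W) - V * (K / 4) * (D * W) by field.
apply: (@le_trans _ _ (V * W - V * W * (K / 4 * D - L / 2))).
  rewrite E; move: (V / 4 * (n2 + n3)) (V / 4 * (W + W)) h1 H => x1 y1 h1.
  move: (V * _ * (n4 + _ + _ + _)) (V * _ * (W + _ + _ + _)) h2 => x2 y2 h2.
  move: (V * (K / 4) * n1) (V * (K / 4) * (D * W)) h3 => x3 y3 h3 H.
  clear -H h1 h2 h3; lra.
by rewrite [leRHS]mulrBr mulr1 lerD2l lerN2.
Qed.

(** The energies give a bound with the factor 1 - X on q-th powers; Bernoulli's inequality 1 - X <=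
    (1 - X/q)^q takes the q-th root, whence the constant c / q. *)
Lemma Lq_laakso q s : 1 < q ->
  (exists2 c : R, 0 < c & forall delta : R, 0 < delta -> delta <= 1 ->
     exists K L : R, [/\ 0 <= K, 0 <= L, two_point_convex q K L &
       c * delta `^ s <= K / 4 * delta `^ q - L / 2]) ->
  laakso_convex (in_Lq q) (@Lq_dist R q) s.
Proof.
move=> q1 [c c0 tpc]; have q0 : 0 < q by rewrite (lt_trans _ q1).
have qn0 : q != 0 by rewrite gt_eqF.
have energy_ge0 g h : 0 <= Lq_energy q g h.
  by apply: Rintegral_ge0 => x _; exact: powR_ge0.
have energyE g h : Lq_energy q g h = Lq_dist q g h `^ q.
  by symmetry; exact: powRVKr (energy_ge0 g h) qn0.
have distE g h : Lq_dist q g h = Lq_energy q g h `^ q^-1 by [].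
have dist_ge0 g h : 0 <= Lq_dist q g h by exact: powR_ge0.
exists (c / q); first by rewrite divr_gt0.
move=> u a m m' b v Lu La Lm Lm' Lb Lv l delta l0 d0 d1.
have [K [L [K0 L0 tp gain]]] := tpc _ d0 d1.
have := Lq_energy_laakso q1 K0 tp Lu La Lm Lm' Lb Lv; rewrite (distE u v).
have [V0 W0] : 0 <= 4 `^ q :> R /\ 0 <= l `^ q by split; exact: powR_ge0.
have := energy_ge0 u v; move: (Lq_energy q u v) => n0 n00 H.
move: {energy_ge0 distE tpc tp Lu La Lm Lm' Lb Lv} (Lq_dist q) energyE dist_ge0 => rho.
move: (Lq_energy q) H => E H EE rho0 ua am mb am' m'b bv dl.
have E_le g h : rho g h <= l -> E g h <= l `^ q.
  by move=> gh; rewrite EE; exact: (powR_le2 (ltW q0) (rho0 g h) gh).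
have mm : delta `^ q * l `^ q <= E m m'.
  rewrite EE -powRM ?(ltW d0) ?(ltW l0) //.
  exact: (powR_le2 (ltW q0) (mulr_ge0 (ltW d0) (ltW l0)) dl).
have := bound_of_energies V0 W0 K0 L0 H mm (E_le _ _ ua) (E_le _ _ bv) (E_le _ _ am)
  (E_le _ _ mb) (E_le _ _ am') (E_le _ _ m'b) gain.
have l0' := ltW l0; rewrite -powRM // => bound.
set X := c * delta `^ s in bound *.
have X0 : 0 <= X by rewrite mulr_ge0 ?powR_ge0 // ltW.
(* Otherwise the nonnegative energy of [u] and [v] would have a negative upper bound. *)
have X1 : X <= 1.
  have W4 : 0 < (4 * l) `^ q by rewrite powR_gt0 // mulr_gt0.
  by have := le_trans n00 bound; rewrite pmulr_rge0 // subr_ge0.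
have Xq : X / q <= 1 by rewrite ler_pdivrMr // mul1r (le_trans X1) // ltW.
have -> : c / q * delta `^ s = X / q by rewrite /X mulrAC.
have r0 : 0 <= 4 * l * (1 - X / q) by rewrite mulr_ge0 ?subr_ge0 // mulr_ge0.
rewrite -[leRHS](powRVK r0 qn0); apply: powR_le2 => //; first by rewrite invr_ge0 ltW.
apply: (le_trans bound); rewrite [leRHS]powRM ?subr_ge0 ?mulr_ge0 //.
rewrite ler_wpM2l ?powR_ge0 //.
have := @bernoulli_powR _ q (1 - X / q) q1; rewrite subr_ge0 => /(_ Xq).
by rewrite [1 - X / q]addrC addrK mulrN [q * _]mulrC divfK.
Qed.

Lemma Lq_laakso_ge2 q : 2 <= q -> laakso_convex (in_Lq q) (@Lq_dist R q) q.
Proof.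
move=> q2; have tq0 : 0 < 2 `^ q :> R by exact: powR_gt0.
apply: Lq_laakso; first by lra.
exists (2^-1 * (2 `^ q)^-1); first by rewrite mulr_gt0 ?invr_gt0.
move=> delta d0 d1; exists (2 * (2 `^ q)^-1), 0; split.
- by rewrite mulr_ge0 // invr_ge0 ltW.
- exact: lexx.
- exact: two_point_ge2.
by rewrite mul0r subr0 ler_wpM2r ?powR_ge0 //; lra.
Qed.

Lemma Lq_laakso_lt2 q : 1 < q -> q <= 2 -> laakso_convex (in_Lq q) (@Lq_dist R q) 2.
Proof.
move=> q1 q2; have [c c0 tp] := two_point_lt2 q1 q2.
apply: (Lq_laakso q1); exists (c / 128); first by lra.
(* With eta = delta / 16 the gain is c/4 * eta^2 * 16^q >= 4 c eta^2, twice the loss 2 c eta^2; what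
   remains is c delta^2 / 128. *)
move=> delta d0 d1; pose eta := delta / 16.
have eta0 : 0 < eta by rewrite divr_gt0.
exists (c * eta `^ (2 - q)), (4 * c * eta ^+ 2); split.
- by rewrite mulr_ge0 ?powR_ge0 // ltW.
- by rewrite mulr_ge0 ?sqr_ge0 // mulr_ge0 // ltW.
- exact: tp.
have -> : c * eta `^ (2 - q) / 4 * delta `^ q = c / 4 * eta ^+ 2 * 16 `^ q.
  have -> : delta `^ q = 16 `^ q * eta `^ q.
    by rewrite -powRM ?(ltW eta0) // /eta; congr (_ `^ _); field.
  have : eta `^ (2 - q) * eta `^ q = eta ^+ 2.
    by rewrite -powRD ?subrK ?powR_mulrn ?(ltW eta0) // (gt_eqF eta0) implybT.
  by move: (eta `^ (2 - q)) (eta `^ q) => x y <-; field.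
have s16 : 16 <= 16 `^ q :> R by rewrite le1r_powR ?ler1n // ltW.
have c2 : 0 <= c / 4 * eta ^+ 2 by rewrite mulr_ge0 ?sqr_ge0 //; lra.
have e2 : delta `^ 2 = delta ^+ 2 by exact: powR_mulrn 2 (ltW d0).
have := ler_wpM2l c2 s16. rewrite e2.
have -> : eta ^+ 2 = delta ^+ 2 / 256 by rewrite /eta; field.
by lra.
Qed.

End LqSpace.

(** * The metric space and its embeddings *)

Unset Implicit Arguments.

Theorem theorem1p8 (R : realType) (p : R) (hp2 : 2 < p) (hp4 : p <= 4) :
  exists (M : Type) (d : M -> M -> R),
    is_metric d /\
    bilip_embeds_ell d 1 /\
    (forall r : R, p <= r -> bilip_embeds_ell d r) /\
    (forall q : R, 1 < q -> q < p -> ~ bilip_embeds_Lq d q) /\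
    (forall (X : completeNormedModType R) (q : R), 2 <= q -> q < p ->
        unif_convex_power_type X q -> ~ bilip_embeds_normed d X).
Proof.
(* Points are taken as sequences in l_1, so different sign choices naming the same vertex are
   identified and the inclusion is isometric. *)
pose M := {w : nat -> R | exists x : nat * seq bool, w = ell1_pt p x.1 x.2}.
pose d (u v : M) := ell_dist 1 (sval u) (sval v).
have ell1M (u : M) : in_ell 1 (sval u) by have [x ->] := svalP u; exact: in_ell1_pt.
pose pt n eps : M := exist _ (ell1_pt p n eps) (ex_intro _ (n, eps) erefl).
have ptE n eps m del : ell1_pt p n eps = ell1_pt p m del -> pt n eps = pt m del.
  by move=> e; apply: eq_exist.
have no_embedding (Y : Type) (D : Y -> Prop) (rho : Y -> Y -> R) (s : R) (f : M -> Y) :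
    0 <= s -> s < p -> laakso_convex D rho s -> (forall u, D (f u)) ->
    ~ bi_lipschitz d rho f.
  move=> s0 sp conv Df [a [b [a0 [ab bil]]]].
  have fext n eps m del : ell1_pt p n eps = ell1_pt p m del -> f (pt n eps) = f (pt m del).
    by move=> /ptE ->.
  exact: (laakso_convex_no_embedding hp2 s0 sp conv (fun n eps => Df (pt n eps)) fext a0 ab
    (fun n eps m del => bil (pt n eps) (pt m del))).
exists M, d; split; [|split; [|split; [|split]]].
- split; [|split; [|split]].
  + by move=> u v; exact: powR_ge0.
  + move=> u v; split => [|->]; last exact: ell1_dist_refl.
    move=> /(ell1_dist_eq0 (ell1M u) (ell1M v)).
    by case: u v => u hu [v hv] /= uv; apply: eq_exist.
  + by move=> u v; exact: ell1_dist_sym.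
  + by move=> u v w; exact: ell1_dist_triangle.
- exists (fun u => sval u); split => //; exists 1, 1; split => //; split => // u v.
  by rewrite mul1r lexx.
(* The map to l_r uses a chosen representative (n, eps) of each point; the distance bounds hold for
   every choice. *)
- move=> r pr; pose x (u : M) := sval (cid (svalP u)).
  have xE (u : M) : sval u = ell1_pt p (x u).1 (x u).2 by exact: svalP (cid (svalP u)).
  exists (fun u => ellr_pt p (x u).1 (x u).2); split.
    by move=> u; exact: in_ellr_pt.
  exists 8^-1, 16; split; first by rewrite invr_gt0.
  split; first by lra.
  by move=> u v; rewrite /d !xE; exact: ellr_dist_bounds.
(* L_q has convexity exponent [q] for q >= 2 and 2 below; both are smaller than [p]. *)
- move=> q q1 qp [f [Lf]]; have [q2|q2] := leP 2 q.
    by apply: (no_embedding _ _ _ q f _ qp (Lq_laakso_ge2 q2) Lf); lra.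
  by apply: (no_embedding _ _ _ 2 f _ hp2 (Lq_laakso_lt2 q1 (ltW q2)) Lf); lra.
- move=> X q q2 qp [C [C0 convX]] [f].
  have q1 : 1 <= q by lra.
  by apply: (no_embedding _ _ _ q f _ qp (unif_convex_laakso q1 C0 convX)) => //; lra.
Qed.
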